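(* There exist absolute constants $c_1,c_2\in\mathbb N$ such that for every $d\in\mathbb N$, every positive function $\omega$ on $\mathbb Z^d$ with $\sum_{\mathbf k\in\mathbb Z^d}\omega(\mathbf k)^{-2}<\infty$, and every $m\in\mathbb N$, $$ g_{c_1m}({\rm APP}_{\infty,d})\le c_2\,a_{m+1}({\rm APP}_{\infty,d})=c_2\Big(\sum_{k=m+1}^\infty\lambda_{k,d}\Big)^{1/2};$$ in other words $e(c_1m,{\rm APP}_{\infty,d};\Lambda^{\rm std})\le c_2\, e(m,{\rm APP}_{\infty,d};\Lambda^{\rm all})$.
   Context: $\mathbb T^d=[0,1]^d$ is the $d$-dimensional torus with Lebesgue measure. For $f\in L_1(\mathbb T^d)$, $\hat f(\mathbf k)=\int_{\mathbb T^d}f(\mathbf x)e^{-2\pi i\mathbf k\cdot\mathbf x}d\mathbf x$. $H^\omega(\mathbb T^d)$ is the Hilbert space of $f\in L_2(\mathbb T^d)$ with $\|f\|_{H^\omega}^2=\sum_{\mathbf k\in\mathbb Z^d}|\hat f(\mathbf k)|^2\omega(\mathbf k)^2<\infty$; under the summability assumption it is a reproducing kernel Hilbert space of continuous functions embedded in $L_\infty(\mathbb T^d)$ (sup norm). ${\rm APP}_{\infty,d}:H^\omega(\mathbb T^d)\to L_\infty(\mathbb T^d)$, $f\mapsto f$. $\{\lambda_{k,d}\}_{k\in\mathbb N}$ is the nonincreasing rearrangement of $\{\omega(\mathbf k)^{-2}\}_{\mathbf k\in\mathbb Z^d}$. $\Lambda^{\rm all}$ is the class of all continuous linear functionals on $H^\omega(\mathbb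 T^d)$ and $\Lambda^{\rm std}$ the class of point evaluations $f\mapsto f(\mathbf x)$. For $\Lambda\in\{\Lambda^{\rm all},\Lambda^{\rm std}\}$, $e(n,{\rm APP}_{\infty,d};\Lambda)$ is the infimum, over algorithms $A(f)=\phi(L_1f,\dots,L_nf)$ with $L_i\in\Lambda$ and arbitrary $\phi:\mathbb C^n\to L_\infty(\mathbb T^d)$, of $\sup_{\|f\|_{H^\omega}\le1}\|f-A(f)\|_\infty$. The sampling number is $g_n({\rm APP}_{\infty,d})=e(n,{\rm APP}_{\infty,d};\Lambda^{\rm std})$ and the approximation number is $a_{n+1}({\rm APP}_{\infty,d})=e(n,{\rm APP}_{\infty,d};\Lambda^{\rm all})$ (the infimum of worst-case errors of linear operators of rank at most $n$). *)

(* Defs.v *)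
From HB Require Import structures.
From mathcomp Require Import all_boot all_order all_algebra.
From mathcomp Require Import all_classical all_reals all_analysis.
From mathcomp Require Import complex.
Set Implicit Arguments. Unset Strict Implicit. Unset Printing Implicit Defensive.
Import Order.TTheory GRing.Theory Num.Theory.
Import numFieldNormedType.Exports.
Local Open Scope classical_set_scope.
Local Open Scope ring_scope.
Local Open Scope complex_scope.
Local Notation normc := ComplexField.Normc.normc.

Section Defs.
Variable R : realType.

Definition freq (d : nat) := 'I_d -> int.
Definition pt (d : nat) := 'I_d -> R.
Definition torus (d : nat) : set (pt d) := [set x | forall i, 0 <= x i <= 1].

Definition dotp d (k : freq d) (x : pt d) : R := \sum_(i < d) (k i)%:~R * x i.

Definition ek d (k : freq d) (x : pt d) : R[i] :=
  cos (2 * pi * dotp k x) +i* sin (2 * pi * dotp k x).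

(* a function on the torus given through its Fourier coefficients c : Z^d -> C *)
Definition coefs (d : nat) := freq d -> R[i].

Definition cube_freq d N (j : {ffun 'I_d -> 'I_(2 * N).+1}) : freq d :=
  fun i => (j i)%:Z - N%:Z.
Definition psum d (c : coefs d) (x : pt d) (N : nat) : R[i] :=
  \sum_(j : {ffun 'I_d -> 'I_(2 * N).+1}) c (cube_freq j) * ek (cube_freq j) x.

Definition fval d (c : coefs d) (x : pt d) : R[i] :=
  limn (fun N => complex.Re (psum c x N)) +i* limn (fun N => complex.Im (psum c x N)).

Definition Hnorm2 d (w : freq d -> R) (c : coefs d) : \bar R :=
  (\esum_(k in [set: freq d]) ((normc (c k)) ^+ 2 * (w k) ^+ 2)%:E)%E.

Definition Hw d (w : freq d -> R) : set (coefs d) := [set c | (Hnorm2 w c < +oo)%E].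

Definition Lstd d : set (coefs d -> R[i]) :=
  [set L | exists2 x, torus x & L = fun c => fval c x].

Definition Lall d (w : freq d -> R) : set (coefs d -> R[i]) :=
  [set L | (forall (a b : R[i]) (f g : coefs d), Hw w f -> Hw w g ->
               L (fun k => a * f k + b * g k) = a * L f + b * L g)
        /\ (forall f, Hw w f -> forall eps : R, 0 < eps -> exists2 del : R, 0 < del &
               forall g, Hw w g -> (Hnorm2 w (fun k => (g k - f k)%R) < (del ^+ 2)%:E)%E ->
                 normc (L g - L f) < eps)].

Definition wc_err d (w : freq d -> R) n (L : 'I_n -> coefs d -> R[i])
  (phi : ('I_n -> R[i]) -> pt d -> R[i]) : \bar R :=
  ereal_sup [set e | exists c x, [/\ Hw w c, (Hnorm2 w c <= 1)%E, torus x &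
             e = (normc (fval c x - phi (fun i => L i c) x))%:E]].

Definition nth_err d (w : freq d -> R) (Lam : set (coefs d -> R[i])) (n : nat) : \bar R :=
  ereal_inf [set e | exists (L : 'I_n -> coefs d -> R[i])
                            (phi : ('I_n -> R[i]) -> pt d -> R[i]),
                       (forall i, Lam (L i)) /\ e = wc_err w L phi].

(* sampling number g_n and approximation number a_{n+1} *)
Definition gn d (w : freq d -> R) n := nth_err w (@Lstd d) n.
Definition an1 d (w : freq d -> R) n := nth_err w (Lall w) n.

End Defs.

(* Main.v *)
(** Write lam k = w(k)^-2, feat x = (w(k)^-1 e_k(x))_k and K(x,y) = <feat x, feat y>
for the reproducing kernel, and let tau be the sum of lam over the frequencies
outside a set s of m frequencies carrying the largest values of lam.

Approximation numbers: a_(m+1)^2 >= tau because the kernel of m linear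
functionals contains, by averaging over the torus, a unit vector of large sup
norm; the average is computed on a finite grid, where the characters of a cube of
frequencies are exactly orthogonal.

Sampling numbers: let D_n(X) = det (K(x_i,x_j)) for n points X. By Cauchy-Binet,
the average of D_n is E_n, the sum of lam(k_1)...lam(k_n) over injective tuples,
and by Hadamard's inequality D_n <= n^n / n! E_n. A unit vector f vanishing on X
gives D_(n+1)(X,x) >= |f(x)|^2 D_n(X). If every set of 2m points admitted
such an f with |f(x)|^2 > 256 tau, then starting from m points with D_m >= E_m / 2
and adding m points would give D_2m >= (256 tau)^m E_m / 2, whereas
D_2m <= (2m)^(2m) / (2m)! E_2m <= (64 tau)^m E_m. So for some 2m points the
values determine f in the unit ball up to an error 2 (256 tau)^(1/2) = 32 tau^(1/2). *)

Require Import Defs.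
From HB Require Import structures.
From mathcomp Require Import all_boot all_order all_algebra all_fingroup.
From mathcomp Require Import sesquilinear spectral zify ring lra.
From mathcomp Require Import all_classical all_reals all_analysis.
From mathcomp Require Import complex.
Set Implicit Arguments. Unset Strict Implicit. Unset Printing Implicit Defensive.
Import Order.TTheory GRing.Theory Num.Theory.
Import numFieldNormedType.Exports.
Local Open Scope classical_set_scope.
Local Open Scope ring_scope.

(** * Gram determinants *)

(** Cauchy-Binet over all maps instead of n-subsets, so that each product of minors is counted [n!]
    times and [T] needs no order. In the Leibniz expansions the second permutation is rewritten
    relative to the first, [s]; the sum over [f] then factors over positions, and each [s]
    contributes the same determinant. *)
Lemma sum_det_mul (R : comNzRingType) (T : finType) n (A B : 'I_n -> T -> R) :
  \sum_(f : {ffun 'I_n -> T})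
     \det (\matrix_(i, j) A i (f j)) * \det (\matrix_(i, j) B i (f j)) =
  n`!%:R * \det (\matrix_(i, j) \sum_t A i t * B j t).
Proof.
have detE (D : 'I_n -> T -> R) (f : {ffun 'I_n -> T}) :
    \det (\matrix_(i, j) D i (f j)) =
    \sum_(s : 'S_n) (-1) ^+ s * \prod_j D ((s^-1)%g j) (f j).
  apply: eq_bigr => s _; congr (_ * _); rewrite (reindex_inj (@perm_inj _ (s^-1)%g)) /=.
  by apply: eq_bigr => j _; rewrite !mxE permKV.
under eq_bigr do rewrite !detE big_distrlr /=.
rewrite exchange_big /=.
transitivity (\sum_(s : 'S_n) \det (\matrix_(i, j) \sum_t A i t * B j t)); last first.
  by rewrite sumr_const card_Sn mulr_natl.
apply: eq_bigr => s _; rewrite exchange_big /=.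
rewrite (reindex_inj (inj_comp (mulIg s) invg_inj)) /= [RHS]/determinant.
apply: eq_bigr => u _.
transitivity ((-1) ^+ u *
    \sum_(f : {ffun 'I_n -> T}) \prod_j (A ((s^-1)%g j) (f j) * B (((u^-1 * s)^-1)%g j) (f j))).
  rewrite mulr_sumr; apply: eq_bigr => f _; rewrite big_split /=.
  rewrite odd_permM odd_permV signr_addb.
  rewrite mulrACA; congr (_ * _); rewrite mulrCA -expr2 sqrr_sign mulr1.
  by [].
rewrite -(bigA_distr_bigA (fun j t => A ((s^-1)%g j) t * B (((u^-1 * s)^-1)%g j) t)).
congr (_ * _); rewrite (reindex_inj (@perm_inj _ s)) /=.
apply: eq_bigr => j _; rewrite !mxE; apply: eq_bigr => t _.
by rewrite invMg invgK permM !permK.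
Qed.

Section Gram.
Local Open Scope sesquilinear_scope.
Variable C : numClosedFieldType.
Implicit Types (T : finType).

Lemma conjCM (x y : C) : (x * y)^* = x^* * y^*.
Proof. exact: rmorphM. Qed.

Lemma conjCB (x y : C) : (x - y)^* = x^* - y^*.
Proof. exact: rmorphB. Qed.

Lemma conjC_sum (I : Type) (r : seq I) (P : pred I) (F : I -> C) :
  (\sum_(i <- r | P i) F i)^* = \sum_(i <- r | P i) (F i)^*.
Proof. exact: rmorph_sum. Qed.

Definition gram T n (V : 'I_n -> T -> C) : 'M[C]_n :=
  \matrix_(i, j) \sum_t V i t * (V j t)^*.

Lemma cauchy_binet_gram T n (V : 'I_n -> T -> C) :
  \sum_(f : {ffun 'I_n -> T}) `|\det (\matrix_(i, j) V i (f j))| ^+ 2 =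
  n`!%:R * \det (gram V).
Proof.
rewrite -(sum_det_mul V (fun i t => (V i t)^*)); apply: eq_bigr => f _.
rewrite normCK; congr (_ * _); rewrite -det_map_mx; congr (\det _).
by apply/matrixP => i j; rewrite !mxE.
Qed.

Lemma det_gram_ge0 T n (V : 'I_n -> T -> C) : 0 <= \det (gram V).
Proof.
have : 0 <= n`!%:R * \det (gram V).
  by rewrite -cauchy_binet_gram sumr_ge0 // => f _; rewrite exprn_ge0.
by rewrite pmulr_rge0 // ltr0n fact_gt0.
Qed.

(* Adding a coordinate completes [y] to a unit vector; then [gram V - b b^*] is
   the Gram matrix of the components of the rows orthogonal to [y^*]. *)
Lemma det_gram_bessel T n (V : 'I_n -> T -> C) (y : T -> C) :
  \sum_t `|y t| ^+ 2 <= 1 ->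
  0 <= \det (\matrix_(i, j) (gram V i j -
        (\sum_t V i t * y t) * (\sum_t V j t * y t)^*)).
Proof.
move=> y1.
pose b i := \sum_t V i t * y t.
pose y' (t : T + unit) := if t is inl u then y u else sqrtC (1 - \sum_t `|y t| ^+ 2).
pose V' i (t : T + unit) := (if t is inl u then V i u else 0) - b i * (y' t)^*.
suff -> : \matrix_(i, j) (gram V i j - b i * (b j)^*) = gram V' by exact: det_gram_ge0.
have sumE (F : T + unit -> C) : \sum_t F t = \sum_t F (inl t) + F (inr tt).
  by rewrite big_sumType /= (big_pred1 tt) // => -[].
have y'1 : \sum_t (y' t)^* * y' t = 1.
  under eq_bigr do rewrite mulrC -normCK.
  by rewrite sumE /= ger0_norm ?sqrtC_ge0 ?subr_ge0 // sqrtCK addrC subrK.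
pose V0 i (t : T + unit) := if t is inl u then V i u else 0.
have bE i : \sum_t V0 i t * y' t = b i by rewrite sumE /= mul0r addr0.
apply/matrixP => i j; rewrite !mxE.
have -> : \sum_t V i t * (V j t)^* = \sum_t V0 i t * (V0 j t)^*.
  by rewrite sumE /= mul0r addr0.
transitivity (\sum_t (V0 i t * (V0 j t)^* - (b j)^* * (V0 i t * y' t)
    - b i * (V0 j t * y' t)^* + b i * (b j)^* * ((y' t)^* * y' t))); last first.
  apply: eq_bigr => t _; rewrite -/(V0 i t) -/(V0 j t).
  rewrite (_ : V' i t = V0 i t - b i * (y' t)^*) // (_ : V' j t = V0 j t - b j * (y' t)^*) //.
  by rewrite conjCB !conjCM conjCK; ring.
rewrite big_split /= !sumrB -!mulr_sumr y'1 bE -conjC_sum bE; ring.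
Qed.

(** The eigenvalues of [P], the product of [U] with its adjoint, are nonnegative with sum n^2, so
    AM-GM bounds their product by (n^2 / n)^n. *)
Lemma hadamard n (U : 'M[C]_n) :
  (forall i j, `|U i j| = 1) -> `|\det U| ^+ 2 <= n%:R ^+ n.
Proof.
move=> U1; pose P := U *m U ^t*.
have detP : \det P = `|\det U| ^+ 2.
  by rewrite det_mulmx normCK -det_map_mx -map_trmx det_tr.
have Pn : P \is normalmx.
  apply/normalmxP; rewrite /P.
  have -> // : (U *m U ^t*) ^t* = U *m U ^t*.
  by rewrite trmx_mul map_mxM trmxCK.
rewrite -detP.
have /orthomx_spectralP := Pn.
set Q := spectralmx P; set D := spectral_diag P => PE.
have Qu : Q \in unitmx by exact: spectral_unit.
have Qy : Q \is unitarymx by exact: spectral_unitarymx.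
have DE : diag_mx D = (Q *m U) *m (Q *m U) ^t*.
  rewrite trmx_mul map_mxM -(invmx_unitary Qy) mulmxA -(mulmxA Q) -/P PE.
  by rewrite !mulmxA mulmxV // mul1mx mulmxK.
have D0 i : 0 <= D 0 i.
  have := congr1 (fun M : matrix C n n => M i i) DE; rewrite !mxE eqxx mulr1n => ->.
  by apply: sumr_ge0 => k _; rewrite !mxE mul_conjC_ge0.
have -> : \det P = \prod_i D 0 i.
  by rewrite PE !det_mulmx mulrAC -det_mulmx mulVmx // det1 mul1r det_diag.
have trP : \sum_i D 0 i = n%:R ^+ 2.
  rewrite -mxtrace_diag -[diag_mx D]mulmx1 -(mulmxV Qu) mulmxA mxtrace_mulC mulmxA -PE.
  transitivity (\sum_(i < n) \sum_(j < n) (1 : C)); last first.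
    by rewrite sumr_const card_ord sumr_const card_ord -natrX -mulrnA mulnn.
  apply: eq_bigr => i _; rewrite !mxE; apply: eq_bigr => j _.
  by rewrite !mxE -normCK U1 expr1n.
case: n => [|n] in U P D D0 trP U1 detP Pn Q PE Qu Qy DE *; first by rewrite big_ord0 expr0.
have := leif_AGM (A := 'I_n.+1) (fun i _ => D0 i); rewrite card_ord trP.
by move=> /leifP; rewrite expr2 mulfK ?pnatr_eq0 //; case: ifP => _ => [/eqP ->|/ltW].
Qed.

End Gram.

(** * Sums over injective tuples *)

Section InjectiveSums.
Variables (R : numDomainType) (T : finType).

(** This is [n!] times the n-th elementary symmetric polynomial in the values of [l]. *)
Definition injsum n (l : T -> R) : R :=
  \sum_(f : {ffun 'I_n -> T} | injectiveb f) \prod_i l (f i).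

Lemma sum_ffun_ord n (i : 'I_n.+1) (F : {ffun 'I_n.+1 -> T} -> R) :
  \sum_f F f =
  \sum_(t : T) \sum_(g : {ffun 'I_n -> T})
    F [ffun j => if unlift i j is Some k then g k else t].
Proof.
rewrite pair_big /=.
pose h (p : T * {ffun 'I_n -> T}) : {ffun 'I_n.+1 -> T} :=
  [ffun j => if unlift i j is Some k then p.2 k else p.1].
rewrite (reindex h) //=.
exists (fun f : {ffun 'I_n.+1 -> T} => (f i, [ffun k => f (lift i k)])) => [[t g] _|f _].
  rewrite /h ffunE unlift_none; congr (_, _).
  by apply/ffunP => k; rewrite !ffunE liftK.
by apply/ffunP => j; rewrite !ffunE; case: unliftP => [k ->|->] //; rewrite ffunE.
Qed.

Lemma injsum_ge0 n l : (forall t, 0 <= l t) -> 0 <= injsum n l.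
Proof. by move=> l0; apply: sumr_ge0 => f _; apply: prodr_ge0. Qed.

Lemma injsum_le_exp n l : (forall t, 0 <= l t) -> injsum n l <= (\sum_t l t) ^+ n.
Proof.
move=> l0; rewrite -[n in _ ^+ n]card_ord -prodr_const bigA_distr_bigA /=.
rewrite /injsum big_mkcond /=; apply: ler_sum => f _.
by case: ifP => // _; apply: prodr_ge0.
Qed.

(* An injective [f] takes at most [m] values in [S], hence at least [n.+1 - m]
   outside it. *)
Lemma injsum_succ_le n m (S : {pred T}) l : (forall t, 0 <= l t) ->
  (#|S| <= m)%N ->
  (n.+1 - m)%:R * injsum n.+1 l <=
  n.+1%:R * ((\sum_(t | t \notin S) l t) * injsum n l).
Proof.
move=> l0 Sm.
have -> : n.+1%:R * ((\sum_(t | t \notin S) l t) * injsum n l) =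
  \sum_(i < n.+1) (\sum_(t | t \notin S) l t) * injsum n l.
  by rewrite sumr_const card_ord mulr_natl.
apply: (@le_trans _ _ (\sum_(i < n.+1) \sum_(f : {ffun 'I_n.+1 -> T} |
    injectiveb f && (f i \notin S)) \prod_j l (f j))).
  rewrite (eq_bigr (fun i => \sum_(f : {ffun 'I_n.+1 -> T} | injectiveb f)
    if f i \notin S then \prod_j l (f j) else 0)); last by move=> i _; rewrite big_mkcondr.
  rewrite exchange_big /= mulr_sumr; apply: ler_sum => f /injectiveP finj.
  rewrite -big_mkcond /= sumr_const -[leRHS]mulr_natl ler_wpM2r ?prodr_ge0 // ler_nat.
  rewrite leq_subLR; have := cardC (fun i => f i \in S); rewrite card_ord.
  set c1 := #|_|; set c2 := #|_|; move=> <-.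
  rewrite leq_add // (leq_trans _ Sm) // /c1 -(fintype.card_image finj); apply: subset_leq_card.
  by apply/fintype.subsetP => t /fintype.imageP [i fi ->].
(* Removing coordinate [i] leaves an injective map; letting the removed value range over everything
   outside [S], even over values already taken, only enlarges the sum. *)
apply: ler_sum => i _.
rewrite big_mkcond /= (sum_ffun_ord i) /= big_distrl /= [leRHS]big_mkcond /=.
apply: ler_sum => t _; rewrite /injsum mulr_sumr.
case: ifPn => tS; last first.
  by rewrite big1 // => g _; rewrite ffunE unlift_none (negbTE tS) andbF.
rewrite [leRHS]big_mkcond /=; apply: ler_sum => g _.
rewrite ffunE unlift_none tS andbT.
case: ifPn => [/injectiveP fi|_]; last by case: ifP => // _; rewrite mulr_ge0 ?prodr_ge0.
have -> : injectiveb g.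
  apply/injectiveP => j k gjk; apply: (@lift_inj _ i); apply: fi.
  by rewrite !ffunE !liftK.
rewrite (bigD1_ord i) //= ffunE unlift_none.
by under eq_bigr do rewrite ffunE liftK.
Qed.

End InjectiveSums.

Lemma le_mean_exists (R : numDomainType) (I : finType) (F : I -> R) (c : R) :
  (0 < #|I|)%N -> c \is Num.real -> (forall x, F x \is Num.real) ->
  #|I|%:R * c <= \sum_x F x -> exists x, c <= F x.
Proof.
move=> /card_gt0P [x0 _] cR FR cF; apply/existsP; apply: contraLR cF => /existsPn cF.
have ltF x : F x < c by rewrite real_ltNge.
rewrite -real_ltNge ?rpred_sum ?rpredM ?realn // mulr_natl -sumr_const.
by apply: ltr_sum => [|x _]; [apply/hasP; exists x0 => //; rewrite mem_index_enum|].
Qed.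

(** * Upper bounds and averages of Gram determinants *)

Section GramBounds.
Variables (C : numClosedFieldType) (T : finType).
Implicit Types (a : T -> C).

Lemma det_scale_cols n a (U : 'I_n -> T -> C) (f : {ffun 'I_n -> T}) :
  \det (\matrix_(i, j) (a (f j) * U i (f j))) =
  (\prod_j a (f j)) * \det (\matrix_(i, j) U i (f j)).
Proof.
have -> : \matrix_(i, j) (a (f j) * U i (f j)) =
   (\matrix_(i, j) U i (f j)) *m diag_mx (\row_j a (f j)).
  by apply/matrixP => i j; rewrite mul_mx_diag !mxE mulrC.
rewrite det_mulmx det_diag mulrC; congr (_ * _).
by apply: eq_bigr => j _; rewrite mxE.
Qed.

Lemma det_noninj n (U : 'I_n -> T -> C) (f : {ffun 'I_n -> T}) :
  ~~ injectiveb f -> \det (\matrix_(i, j) U i (f j)) = 0.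
Proof.
case/injectivePn => i [j ij fij]; rewrite -det_tr.
by apply: (determinant_alternate ij) => k; rewrite !mxE fij.
Qed.

(** The weights factor out of the columns of each minor, and a minor with a repeated column
    vanishes, so Cauchy-Binet retains only injective tuples. *)
Lemma det_gram_scale n a (U : 'I_n -> T -> C) :
  n`!%:R * \det (gram (fun i t => a t * U i t)) =
  \sum_(f : {ffun 'I_n -> T} | injectiveb f)
    (\prod_j `|a (f j)| ^+ 2) * `|\det (\matrix_(i, j) U i (f j))| ^+ 2.
Proof.
rewrite -cauchy_binet_gram [RHS]big_mkcond /=; apply: eq_bigr => f _.
rewrite det_scale_cols normrM exprMn; case: ifPn => [_|/det_noninj -> ].
  by rewrite normr_prod -prodrXl.
by rewrite normr0 expr0n mulr0.
Qed.

Lemma det_gram_le n a (U : 'I_n -> T -> C) : (forall i t, `|U i t| = 1) ->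
  n`!%:R * \det (gram (fun i t => a t * U i t)) <=
  n%:R ^+ n * injsum n (fun t => `|a t| ^+ 2).
Proof.
move=> U1; rewrite det_gram_scale /injsum mulr_sumr; apply: ler_sum => f _.
rewrite mulrC; apply: ler_wpM2r; first by apply: prodr_ge0 => j _; rewrite exprn_ge0.
by apply: hadamard => i j; rewrite mxE.
Qed.

Variables (G : finType) (E : G -> T -> C).
Hypothesis Eorth : forall t u, \sum_g E g t * (E g u)^* = (#|G| * (t == u))%:R.

(** For a fixed injective tuple of frequencies, a second use of Cauchy-Binet, now over the grid,
    meets the Gram matrix of distinct characters, which is [#|G|] times the identity by [Eorth]. *)
Lemma sum_det_gram n a :
  \sum_(X : {ffun 'I_n -> G}) \det (gram (fun i t => a t * E (X i) t)) =
  #|G|%:R ^+ n * injsum n (fun t => `|a t| ^+ 2).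
Proof.
have fact0 : (n`!%:R : C) != 0 by rewrite pnatr_eq0 -lt0n fact_gt0.
apply: (mulfI fact0); rewrite mulr_sumr.
under eq_bigr do rewrite det_gram_scale.
rewrite exchange_big /= /injsum !mulr_sumr; apply: eq_bigr => f /injectiveP finj.
rewrite -mulr_sumr mulrA mulrC; congr (_ * _).
under eq_bigr => X _.
  rewrite (_ : \matrix_(i, j) _ = (\matrix_(i, j) E (X j) (f i))^T); last first.
    by apply/matrixP => i j; rewrite !mxE.
  rewrite det_tr; over.
rewrite (cauchy_binet_gram (fun i g => E g (f i))); congr (_ * _).
have -> : gram (fun i g => E g (f i)) = (#|G|%:R)%:M.
  apply/matrixP => i j; rewrite !mxE Eorth (inj_eq finj).
  by case: eqP => _; rewrite ?muln1 ?muln0.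
by rewrite det_scalar.
Qed.

Lemma exists_det_gram_ge n a : (0 < #|G|)%N ->
  exists X : {ffun 'I_n -> G},
    injsum n (fun t => `|a t| ^+ 2) <= \det (gram (fun i t => a t * E (X i) t)).
Proof.
move=> G0; apply: le_mean_exists.
- by rewrite card_ffun expn_gt0 G0.
- by apply/ger0_real/injsum_ge0 => t; rewrite exprn_ge0.
- by move=> X; apply/ger0_real/det_gram_ge0.
- by rewrite sum_det_gram card_ffun card_ord natrX.
Qed.

End GramBounds.

(** * Orthonormal bases of kernels of matrices *)

Section OrthonormalKernel.
Local Open Scope sesquilinear_scope.
Variable C : numClosedFieldType.

(** Gram-Schmidt applied to a basis of the left kernel; rank-nullity gives the dimension bound. *)
Lemma unitary_kernel M m (A : 'M[C]_(M, m)) :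
  exists r (B : 'M[C]_(r, M)), [/\ (M <= r + m)%N, B *m A = 0 & B \is unitarymx].
Proof.
pose K := row_base (kermx A); exists (\rank (kermx A)), (schmidt K); split.
- by rewrite mxrank_ker addnC -leq_subLR leq_sub2l // rank_leq_col.
- apply/sub_kermxP; rewrite eqmx_schmidt_free ?row_base_free //.
  by rewrite eq_row_base.
- by apply: schmidt_unitarymx; rewrite rank_leq_col.
Qed.

(** The sum is a diagonal entry of the orthogonal projection [P]. Since [P] is Hermitian and
    idempotent, that entry is the squared norm of its row, hence at least its own square. *)
Lemma unitary_col_norm r M (B : 'M[C]_(r, M)) k : B \is unitarymx ->
  \sum_i `|B i k| ^+ 2 <= 1.
Proof.
move=> /unitarymxP BB; pose P := B ^t* *m B.
have PP : P *m P = P by rewrite /P mulmxA -(mulmxA _ B) BB mulmx1.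
have Pk : P k k = \sum_i `|B i k| ^+ 2.
  by rewrite !mxE; apply: eq_bigr => i _; rewrite !mxE mulrC normCK.
have P0 : 0 <= P k k by rewrite Pk sumr_ge0 // => i _; rewrite exprn_ge0.
have PH l : P l k = (P k l)^*.
  rewrite !mxE conjC_sum; apply: eq_bigr => i _.
  by rewrite !mxE conjCM conjCK mulrC.
have : P k k ^+ 2 <= P k k.
  have PkkE : P k k = \sum_l P k l * P l k by rewrite -{1}PP mxE.
  rewrite [leRHS]PkkE (bigD1 k) //= expr2.
  by rewrite lerDl sumr_ge0 // => l _; rewrite PH mul_conjC_ge0.
rewrite -Pk expr2; have [->|Pn0] := eqVneq (P k k) 0; first by rewrite ler01.
by rewrite -[leRHS]mulr1 ler_pM2l // lt_def Pn0.
Qed.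

Lemma unitary_norm_sum r M (B : 'M[C]_(r, M)) : B \is unitarymx ->
  \sum_k \sum_i `|B i k| ^+ 2 = r%:R.
Proof.
move=> /unitarymxP BB; rewrite exchange_big /=.
transitivity (\tr (1%:M : 'M[C]_r)); last by rewrite mxtrace1.
rewrite -BB; apply: eq_bigr => i _; rewrite mxE; apply: eq_bigr => k _.
by rewrite !mxE normCK.
Qed.

End OrthonormalKernel.

(** * Characters on finite grids *)

Section KernelPeak.
Local Open Scope sesquilinear_scope.
Variables (C : numClosedFieldType) (T G : finType) (E : G -> T -> C).
Hypothesis Eorth : forall t u, \sum_g E g t * (E g u)^* = (#|G| * (t == u))%:R.

Lemma parseval (c : T -> C) :
  \sum_g `|\sum_t c t * E g t| ^+ 2 = #|G|%:R * \sum_t `|c t| ^+ 2.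
Proof.
transitivity (\sum_g \sum_t \sum_u c t * (c u)^* * (E g t * (E g u)^*)).
  apply: eq_bigr => g _; rewrite normCK conjC_sum big_distrlr /=.
  by apply: eq_bigr => t _; apply: eq_bigr => u _; rewrite conjCM; ring.
rewrite exchange_big mulr_sumr; apply: eq_bigr => t _ /=.
rewrite exchange_big (bigD1 t) //= [X in _ + X]big1 ?addr0 => [|u ut].
  by rewrite -mulr_sumr Eorth eqxx muln1 normCK mulrC.
by rewrite -mulr_sumr Eorth eq_sym (negbTE ut) muln0 mulr0.
Qed.

(** The rows of [B] are an orthonormal basis of the vectors annihilated by [A]. At a grid point [g],
    the largest squared value over unit vectors of this space is the sum over [i] of [|v g i|^2]. By
    Parseval its grid average is the sum of [q t * |a t|^2], and some [g] reaches the average. *)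
Lemma exists_kernel_peak m (A : T -> 'I_m -> C) (a : T -> C) (S : {pred T}) (th : C) :
  (0 < #|G|)%N -> (m <= #|S|)%N -> 0 <= th ->
  (forall t, t \in S -> th <= `|a t| ^+ 2) ->
  (forall t, t \notin S -> `|a t| ^+ 2 <= th) ->
  exists (g : G) (z : T -> C),
    [/\ \sum_t `|z t| ^+ 2 <= 1, (forall i, \sum_t z t * A t i = 0) &
        \sum_(t | t \notin S) `|a t| ^+ 2 <= `|\sum_t z t * (a t * E g t)| ^+ 2].
Proof.
move=> G0 Sm th0 thS thSc.
have [r [B [rM BA0 By]]] := unitary_kernel (\matrix_(k < #|T|, i < m) A (enum_val k) i).
pose b i t := B i (enum_rank t).
have sumT (F : 'I_#|T| -> C) : \sum_k F k = \sum_t F (enum_rank t).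
  by rewrite (reindex enum_rank) //; exists enum_val => ? _; rewrite ?enum_rankK ?enum_valK.
pose q t := \sum_i `|b i t| ^+ 2.
have q1 t : q t <= 1 by exact: unitary_col_norm.
have q0 t : 0 <= q t by apply: sumr_ge0 => i _; rewrite exprn_ge0.
have qr : \sum_t q t = r%:R by rewrite -(unitary_norm_sum By) sumT.
(* Bathtub argument: [q] has total mass at least [#|T| - m], so what it lacks outside [S] is made up
   inside [S], where the weights are at least [th] instead of at most [th]. *)
have qS : \sum_(t | t \notin S) `|a t| ^+ 2 <= \sum_t q t * `|a t| ^+ 2.
  rewrite -subr_ge0 (bigID (fun t => t \in S)) /= -addrA -sumrB.
  apply: (@le_trans _ _ (\sum_(t in S) q t * th + \sum_(t | t \notin S) (q t - 1) * th)).
    rewrite -!mulr_suml -mulrDl mulr_ge0 // sumrB addrA.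
    rewrite -(bigID (fun t => t \in S) predT) /=.
    rewrite qr sumr_const subr_ge0 ler_nat.
    rewrite -(leq_add2l #|S|) cardC (leq_trans rM) // addnC leq_add2r.
    by [].
  apply: lerD; apply: ler_sum => t tS; first by rewrite ler_wpM2l ?thS.
  rewrite -{2}[`|a t| ^+ 2]mul1r -mulrBl -subr_ge0 -mulrBr -mulrNN mulr_ge0 //.
    by rewrite opprB subr_ge0.
  by rewrite opprB subr_ge0 thSc.
pose v g i := \sum_t b i t * (a t * E g t).
have [g vg] : exists g, \sum_t q t * `|a t| ^+ 2 <= \sum_i `|v g i| ^+ 2.
  apply: le_mean_exists => //.
  - by apply/ger0_real/sumr_ge0 => t _; rewrite mulr_ge0 ?exprn_ge0.
  - by move=> g; apply/ger0_real/sumr_ge0 => t _; rewrite exprn_ge0.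
  rewrite exchange_big /=.
  under [leRHS]eq_bigr => i _.
    under eq_bigr => g _ do (rewrite /v; under eq_bigr do rewrite mulrA).
    rewrite parseval; over.
  rewrite -mulr_sumr exchange_big /= [X in _ <= _ * X](_ : _ = \sum_t q t * `|a t| ^+ 2) //.
  apply: eq_bigr => t _; rewrite mulr_suml; apply: eq_bigr => i _.
  by rewrite normrM exprMn.
pose s := \sum_i `|v g i| ^+ 2.
have s0 : 0 <= s by apply: sumr_ge0 => i _; rewrite exprn_ge0.
have sq : `|sqrtC s| ^+ 2 = s by rewrite -normrX sqrtCK ger0_norm.
(* Equality case of Cauchy-Schwarz. If [s] is 0, division by zero makes [y] vanish, so the norm of
   [z] is 0 or 1. *)
pose y i := (v g i)^* / sqrtC s.
pose z t := \sum_i y i * b i t.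
have yn : \sum_i `|y i| ^+ 2 = s / s.
  rewrite mulr_suml; apply: eq_bigr => i _.
  by rewrite normrM normfV exprMn norm_conjC exprVn sq.
exists g, z; split.
- have -> : \sum_t `|z t| ^+ 2 = \sum_i `|y i| ^+ 2; last first.
    rewrite yn; have [->|sn0] := eqVneq s 0; first by rewrite mul0r ler01.
    by rewrite divff.
  pose Y : 'rV[C]_r := \row_i y i.
  have zE t : z t = (Y *m B) 0 (enum_rank t).
    by rewrite mxE; apply: eq_bigr => i _; rewrite mxE.
  transitivity (((Y *m B) *m (Y *m B) ^t*) 0 0).
    rewrite mxE sumT; apply: eq_bigr => t _; rewrite zE normCK.
    by congr (_ * _); rewrite !mxE.
  rewrite trmx_mul map_mxM mulmxA -(mulmxA Y) (unitarymxP By) mulmx1 mxE.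
  by apply: eq_bigr => i _; rewrite !mxE normCK.
- move=> i; rewrite /z.
  under eq_bigr do rewrite mulr_suml.
  rewrite exchange_big /= big1 // => j _.
  under eq_bigr do rewrite -mulrA.
  rewrite -mulr_sumr -[RHS](mulr0 (y j)); congr (_ * _).
  have := congr1 (fun Q : matrix C r m => Q j i) BA0; rewrite !mxE sumT => BAji.
  by rewrite -[RHS]BAji; apply: eq_bigr => t _; rewrite mxE enum_rankK.
- rewrite (le_trans qS) // (le_trans vg) // -/s.
  have -> : \sum_t z t * (a t * E g t) = s / sqrtC s.
    rewrite /z; under eq_bigr do rewrite mulr_suml.
    rewrite exchange_big /= mulr_suml; apply: eq_bigr => i _.
    under eq_bigr do rewrite -mulrA.
    by rewrite -mulr_sumr -/(v g i) /y mulrAC normCK [v g i * _]mulrC.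
  rewrite normrM normfV exprMn exprVn sq ger0_norm //.
  have [->|sn0] := eqVneq s 0; first by rewrite expr0n mul0r.
  by rewrite expr2 mulfK.
Qed.

End KernelPeak.

(** * Exponential sums on the uniform grid *)

Section Characters.
Variable R : realType.
Local Notation C := R[i].
Local Open Scope complex_scope.

Definition cis (u : R) : C := cos u +i* sin u.

Lemma cis0 : cis 0 = 1.
Proof. by rewrite /cis cos0 sin0. Qed.

Lemma cisD u v : cis (u + v) = cis u * cis v.
Proof. by rewrite /cis cosD sinD; simpc; congr (_ +i* _); rewrite addrC. Qed.

Lemma cisN u : cis (- u) = Num.conj (cis u).
Proof. by rewrite /cis cosN sinN. Qed.

Lemma norm_cis u : `|cis u| = 1.
Proof. by rewrite normc_def /= cos2Dsin2 sqrtr1. Qed.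

Lemma cisMn u n : cis (u *+ n) = cis u ^+ n.
Proof. by elim: n => [|n IH]; rewrite ?cis0 // mulrS cisD IH exprS. Qed.

Lemma cis_sum (I : finType) (F : I -> R) : cis (\sum_i F i) = \prod_i cis (F i).
Proof. by apply: (big_morph cis cisD cis0). Qed.

Lemma cis_conjK u v : cis u * Num.conj (cis v) = cis (u - v).
Proof. by rewrite -cisN -cisD. Qed.

(** By the double angle formula, the value 1 would force [sin y = 0] at half the angle, but [y] lies
    strictly between 0 and pi. *)
Lemma cis_neq1 b M : (0 < b < M)%N -> cis (2 * pi * (b%:R / M%:R)) != 1.
Proof.
move=> /andP[b0 bM]; have M0 : (0 : R) < M%:R by rewrite ltr0n (leq_trans _ bM).
pose y : R := pi * (b%:R / M%:R).
have siny : 0 < sin y.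
  apply: sin_gt0_pi; rewrite mulr_gt0 ?pi_gt0 ?divr_gt0 ?ltr0n ?(leq_trans _ bM) //=.
  by rewrite -[ltRHS]mulr1 ltr_pM2l ?pi_gt0 // ltr_pdivrMr // mul1r ltr_nat.
apply/eqP => /(congr1 (@complex.Re R)) /=.
rewrite -mulrA -/y mulr_natl cos_mulr2n => cy.
have c1 : cos y ^+ 2 = 1 by lra.
by have := cos2Dsin2 y; rewrite c1 => s0; have := exprn_gt0 2 siny; lra.
Qed.

(** For distinct [p] and [q] this is a full geometric sum of an M-th root of unity other than 1; the
    case [p < q] is reduced to [cis_neq1] by conjugation. *)
Lemma cis_geometric M (p q : 'I_M) :
  \sum_(g < M) cis (2 * pi * ((p%:R - q%:R) * (g%:R / M%:R))) = (M * (p == q))%:R.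
Proof.
have [->|pq] := eqVneq p q.
  rewrite muln1 -[M in RHS]card_ord -sumr_const; apply: eq_bigr => g _.
  by rewrite subrr mul0r mulr0 cis0.
have M0 : (M%:R : R) != 0 by rewrite pnatr_eq0 -lt0n (leq_ltn_trans _ (ltn_ord p)).
pose z := cis (2 * pi * ((p%:R - q%:R) / M%:R)).
have zE g : cis (2 * pi * ((p%:R - q%:R) * (g%:R / M%:R))) = z ^+ g.
  by rewrite -cisMn -[in RHS]mulr_natr; congr cis; ring.
have cisn n : cis (2 * pi * n%:R) = 1.
  by rewrite mulr_natr cisMn mulr_natl /cis cos2pi sin2pi expr1n.
have zM : z ^+ M = 1.
  rewrite -cisMn (_ : _ *+ M = 2 * pi * p%:R - 2 * pi * q%:R).
    by rewrite -cis_conjK !cisn mul1r rmorph1.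
  by rewrite -[LHS]mulr_natr; field.
have z1 : z != 1.
  case: (ltngtP p q) => [pq'|pq'|/val_inj pqE]; last by rewrite pqE eqxx in pq.
    have -> : z = Num.conj (cis (2 * pi * ((q - p)%:R / M%:R))).
      by rewrite -cisN; congr cis; rewrite natrB ?(ltnW pq') //; ring.
    rewrite -conjC1 (inj_eq (inv_inj (@conjCK _))) cis_neq1 // subn_gt0 pq' /=.
    by rewrite (leq_ltn_trans (leq_subr _ _)).
  rewrite /z -natrB ?(ltnW pq') // cis_neq1 // subn_gt0 pq' /=.
  by rewrite (leq_ltn_trans (leq_subr _ _)).
under eq_bigr do rewrite zE.
rewrite muln0; apply: (mulfI (x := z - 1)); first by rewrite subr_eq0.
by rewrite -subrX1 zM subrr mulr0.
Qed.

Section Torus.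
Variable d : nat.
Local Notation cube N := {ffun 'I_d -> 'I_(2 * N).+1}.

(** With [2N+1] points per axis, two distinct frequencies of the cube, whose coordinates differ by
    at most [2N], are never aliased. *)
Definition gpt N (g : cube N) : pt R d := fun i => (g i)%:R / (2 * N).+1%:R.

Lemma torus_gpt N (g : cube N) : torus (gpt g).
Proof.
move=> i; rewrite divr_ge0 //= ler_pdivrMr ?ltr0n // mul1r ler_nat.
exact: ltnW.
Qed.

Lemma norm_ek (k : freq d) (x : pt R d) : `|ek k x| = 1.
Proof. exact: norm_cis. Qed.

Lemma ek_orth N (j l : cube N) :
  \sum_(g : cube N) ek (cube_freq j) (gpt g) * Num.conj (ek (cube_freq l) (gpt g)) =
  (#|{: cube N}| * (j == l))%:R.
Proof.
have ekE (g : cube N) : ek (cube_freq j) (gpt g) * Num.conj (ek (cube_freq l) (gpt g)) =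
    \prod_i cis (2 * pi * (((j i)%:R - (l i)%:R) * ((g i)%:R / (2 * N).+1%:R))).
  rewrite -cis_sum -/(cis _) -/(cis _) cis_conjK /dotp -mulrBr -sumrB mulr_sumr.
  congr cis; apply: eq_bigr => i _; rewrite -mulrBl; congr (_ * (_ * _)).
  by rewrite /cube_freq !rmorphB /= -!pmulrn; ring.
under eq_bigr do rewrite ekE.
rewrite -(bigA_distr_bigA (fun i g => cis (2 * pi * (((j i)%:R - (l i)%:R) *
  ((nat_of_ord g)%:R / (2 * N).+1%:R))))) /=.
under eq_bigr do rewrite cis_geometric.
rewrite -natr_prod big_split /= prod_nat_const card_ffun !card_ord; congr (_ * _)%:R.
have [->|jl] := eqVneq j l; first by rewrite big1 // => i _; rewrite eqxx.
have [i ji] : exists i, j i != l i.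
  apply/existsP; apply: contraNT jl => /existsPn jl.
  by apply/eqP/ffunP => i; apply/eqP; have := jl i; rewrite negbK.
by rewrite (bigD1 i) //= (negbTE ji).
Qed.

End Torus.

End Characters.

(** * Sums over cubes of frequencies *)

Lemma ler_sum_inj (R : numDomainType) (I J : finType) (h : I -> J) (F : J -> R) :
  injective h -> (forall j, 0 <= F j) -> \sum_i F (h i) <= \sum_j F j.
Proof.
move=> hinj F0; rewrite -(big_imset (h := h) (A := predT) F) /=; last by move=> ? ? _ _ /hinj.
by rewrite big_mkcond; apply: ler_sum => j _; case: ifP.
Qed.

Lemma cauchy_schwarz (R : realFieldType) (I : finType) (p q : I -> R) :
  (\sum_i p i * q i) ^+ 2 <= (\sum_i p i ^+ 2) * (\sum_i q i ^+ 2).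
Proof.
have : 0 <= \sum_i \sum_j (p i * q j - p j * q i) ^+ 2.
  by apply: sumr_ge0 => i _; apply: sumr_ge0 => j _; rewrite sqr_ge0.
have -> : \sum_i \sum_j (p i * q j - p j * q i) ^+ 2 =
    \sum_i \sum_j (p i ^+ 2 * q j ^+ 2) + \sum_i \sum_j (q i ^+ 2 * p j ^+ 2)
    - \sum_i \sum_j (p i * q i) * (p j * q j) *+ 2.
  rewrite -big_split -sumrB /=; apply: eq_bigr => i _.
  by rewrite -big_split -sumrB /=; apply: eq_bigr => j _; ring.
under [X in _ - X]eq_bigr do rewrite sumrMnl.
rewrite sumrMnl -!big_distrlr /= => H.
by rewrite expr2; lra.
Qed.

Section Cubes.
Variable d : nat.
Local Notation cube N := {ffun 'I_d -> 'I_(2 * N).+1}.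

Lemma cube_freq_inj N : injective (@cube_freq d N).
Proof.
move=> j l jl; apply/ffunP => i; apply/val_inj.
by have := congr1 (fun k : freq d => k i) jl; rewrite /cube_freq /= => /addIr [].
Qed.

Lemma cube_freq_surj N (k : freq d) : (forall i, (absz (k i) <= N)%N) ->
  exists j : cube N, cube_freq j = k.
Proof.
move=> kN; exists [ffun i => inord (absz (k i + N%:Z))].
apply/funext => i; rewrite /cube_freq ffunE inordK; have := kN i; lia.
Qed.

Lemma absz_cube_freq N (j : cube N) i : (absz (cube_freq j i) <= N)%N.
Proof. by rewrite /cube_freq; have := ltn_ord (j i); lia. Qed.

Lemma cube_freq_widen N N' : (N <= N')%N ->
  exists2 h : cube N -> cube N', injective h & forall j, cube_freq (h j) = cube_freq j.
Proof.
move=> NN'; have surj (j : cube N) : exists j' : cube N', cube_freq j' = cube_freq j.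
  by apply: cube_freq_surj => i; rewrite (leq_trans (absz_cube_freq j i)).
have [h hE] := choice surj; exists h => // j l /(congr1 (@cube_freq d N')).
by rewrite !hE => /cube_freq_inj.
Qed.

Lemma seq_cube (s : seq (freq d)) : exists N0, forall N, (N0 <= N)%N ->
  forall k, k \in s -> exists j : cube N, cube_freq j = k.
Proof.
exists (\max_(k <- s) \max_(i < d) absz (k i))%N => N sN k ks.
apply: cube_freq_surj => i; apply: leq_trans sN.
apply: (@leq_trans (\max_(i < d) absz (k i))%N).
  exact: (leq_bigmax_cond (F := fun i => absz (k i))).
exact: (@leq_bigmax_seq _ _ xpredT (fun k : freq d => \max_(i < d) absz (k i))%N).
Qed.

Definition csum (V : nmodType) N (a : freq d -> V) : V := \sum_(j : cube N) a (cube_freq j).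

Lemma csum_mono (R : numDomainType) (a : freq d -> R) N N' :
  (forall k, 0 <= a k) -> (N <= N')%N -> csum N a <= csum N' a.
Proof.
move=> a0 /cube_freq_widen[h hinj hE]; rewrite /csum.
under eq_bigr do rewrite -hE.
exact: (ler_sum_inj (F := fun j => a (cube_freq j))).
Qed.

Lemma csum_supp (V : nmodType) (a : freq d -> V) (s : seq (freq d)) N : uniq s ->
  (forall k, k \in s -> exists j : cube N, cube_freq j = k) ->
  \sum_(j : cube N | cube_freq j \in s) a (cube_freq j) = \sum_(k <- s) a k.
Proof.
move=> us sN; rewrite -big_filter -(big_map (@cube_freq d N) xpredT a).
apply: perm_big; apply: uniq_perm => //.
  by rewrite map_inj_uniq ?filter_uniq ?index_enum_uniq //; exact: cube_freq_inj.
move=> k; apply/mapP/idP => [[j]|ks]; first by rewrite mem_filter => /andP[? _] ->.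
by have [j jk] := sN k ks; exists j; rewrite // mem_filter jk ks mem_index_enum.
Qed.

Variable R : realType.

Lemma esum_subset (T : choiceType) (A B : set T) (a : T -> \bar R) :
  A `<=` B -> (forall k, (0 <= a k)%E) -> (\esum_(k in A) a k <= \esum_(k in B) a k)%E.
Proof.
move=> AB a0; rewrite [leLHS]esum_mkcond [leRHS]esum_mkcond; apply: le_esum => k _.
case: ifPn => [/set_mem kA|_]; last by case: ifP.
by rewrite mem_set //; exact: AB.
Qed.

Lemma esum_cube N (b : freq d -> R) : (forall k, 0 <= b k) ->
  (\esum_(k in range (@cube_freq d N)) (b k)%:E = (csum N b)%:E)%E.
Proof.
move=> b0; rewrite esum_image; last by move=> ? ? _ _; exact: cube_freq_inj.
rewrite esum_fset //=.
  rewrite /csum -sumEFin [RHS]fsbig_seq ?index_enum_uniq //; apply: eq_fsbigl.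
  by apply/seteqP; split => // j _; rewrite /= mem_index_enum.
by move=> j _; rewrite lee_fin.
Qed.

(** Every finite set of frequencies lies in a cube, so for nonnegative terms the unordered sum is
    the supremum of the cube sums. This reduces infinite sums to uniform bounds on finite ones. *)
Lemma esum_leP (b : freq d -> R) (B : R) : (forall k, 0 <= b k) ->
  (\esum_(k in [set: freq d]) (b k)%:E <= B%:E)%E <-> forall N, csum N b <= B.
Proof.
move=> b0; split=> [bB N|bB].
  rewrite -lee_fin -esum_cube // (le_trans _ bB) //.
  by apply: esum_subset => // k; rewrite lee_fin.
apply: ge_ereal_sup => _ [X [finX _] <-].
have /finite_seqP[s sX] := finX.
have [N0 sN] := seq_cube s.
rewrite -esum_fset //; last by move=> k _; rewrite lee_fin.
apply: (@le_trans _ _ (csum N0 b)%:E); last by rewrite lee_fin.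
rewrite -esum_cube //; apply: esum_subset => [k|k]; last by rewrite lee_fin.
by rewrite sX /= => ks; have [j <-] := sN N0 (leqnn _) k ks; exists j.
Qed.

Lemma csum_cvg (b : freq d -> R) (B : R) : (forall k, 0 <= b k) ->
  (forall N, csum N b <= B) -> cvgn (fun N => csum N b).
Proof.
move=> b0 bB; apply: nondecreasing_is_cvgn.
  by move=> N N' NN'; exact: csum_mono.
by exists B => _ [N _ <-].
Qed.

(** Write [a] as [(a + |a|) - |a|]: both parts are nonnegative with bounded, monotone cube sums. *)
Lemma csum_abs_cvg (a : freq d -> R) (B : R) :
  (forall N, csum N (fun k => `|a k|) <= B) -> cvgn (fun N => csum N a).
Proof.
move=> aB.
have -> : (fun N => csum N a) =
    (fun N => csum N (fun k => a k + `|a k|) - csum N (fun k => `|a k|)).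
  by apply/funext => N; rewrite /csum -sumrB; apply: eq_bigr => j _; rewrite addrK.
apply: is_cvgB; last by apply: (csum_cvg (B := B)).
apply: (csum_cvg (B := B + B)) => [k|N]; first by have := ler_norm (- a k); rewrite normrN; lra.
rewrite /csum big_split lerD // (le_trans _ (aB N)) //.
by apply: ler_sum => j _; exact: ler_norm.
Qed.

End Cubes.

(** * Componentwise limits of complex sequences *)

Section ComplexLimits.
Variable R : realType.
Local Notation C := R[i].
Local Notation normc := ComplexField.Normc.normc.

Lemma normc_ge_absRe (x : C) : `|complex.Re x| <= normc x.
Proof. by case: x => a b; rewrite -sqrtr_sqr ler_wsqrtr // lerDl sqr_ge0. Qed.

Lemma normc_ge_absIm (x : C) : `|complex.Im x| <= normc x.
Proof. by case: x => a b; rewrite -sqrtr_sqr ler_wsqrtr // lerDr sqr_ge0. Qed.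

Lemma ReD (x y : C) : complex.Re (x + y) = complex.Re x + complex.Re y.
Proof. by case: x y => [a b] [e f]. Qed.

Lemma ImD (x y : C) : complex.Im (x + y) = complex.Im x + complex.Im y.
Proof. by case: x y => [a b] [e f]. Qed.

(** Convergence of real and imaginary parts, matching the way [fval] is defined. *)
Definition ccvg (u : nat -> C) (l : C) : Prop :=
  ((fun n => complex.Re (u n)) @ \oo --> complex.Re l) /\
  ((fun n => complex.Im (u n)) @ \oo --> complex.Im l).

Lemma ccvg_cst l : ccvg (fun _ => l) l.
Proof. by split; exact: cvg_cst. Qed.

Lemma ccvgD u v k l : ccvg u k -> ccvg v l -> ccvg (fun n => u n + v n) (k + l).
Proof.
move=> [u1 u2] [v1 v2]; split.
  by rewrite ReD; under eq_fun do rewrite ReD; exact: cvgD.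
by rewrite ImD; under eq_fun do rewrite ImD; exact: cvgD.
Qed.

Lemma ccvgM u v k l : ccvg u k -> ccvg v l -> ccvg (fun n => u n * v n) (k * l).
Proof.
move=> [u1 u2] [v1 v2]; split.
  have -> : (fun n => complex.Re (u n * v n)) = (fun n =>
      complex.Re (u n) * complex.Re (v n) - complex.Im (u n) * complex.Im (v n)).
    by apply/funext => n; case: (u n) (v n) => [a b] [e f].
  have -> : complex.Re (k * l) = complex.Re k * complex.Re l - complex.Im k * complex.Im l.
    by case: (k) (l) => [a b] [e f].
  by apply: cvgB; apply: cvgM.
have -> : (fun n => complex.Im (u n * v n)) = (fun n =>
    complex.Re (u n) * complex.Im (v n) + complex.Im (u n) * complex.Re (v n)).
  by apply/funext => n; case: (u n) (v n) => [a b] [e f].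
have -> : complex.Im (k * l) = complex.Re k * complex.Im l + complex.Im k * complex.Re l.
  by case: (k) (l) => [a b] [e f].
by apply: cvgD; apply: cvgM.
Qed.

Lemma ccvgB u v k l : ccvg u k -> ccvg v l -> ccvg (fun n => u n - v n) (k - l).
Proof.
move=> cu cv; have := ccvgD cu (ccvgM (ccvg_cst (-1)) cv); rewrite mulN1r.
by under eq_fun do rewrite mulN1r.
Qed.

Lemma ccvg_conj u k : ccvg u k -> ccvg (fun n => Num.conj (u n)) (Num.conj k).
Proof.
move=> [u1 u2]; split.
  have -> : (fun n => complex.Re (Num.conj (u n))) = (fun n => complex.Re (u n)).
    by apply/funext => n; case: (u n).
  by have -> : complex.Re (Num.conj k) = complex.Re k by case: (k).
have -> : (fun n => complex.Im (Num.conj (u n))) = (fun n => - complex.Im (u n)).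
  by apply/funext => n; case: (u n).
have -> : complex.Im (Num.conj k) = - complex.Im k by case: (k).
exact: cvgN.
Qed.

Lemma ccvg_sum (I : Type) (r : seq I) (P : pred I) (u : I -> nat -> C) (k : I -> C) :
  (forall i, ccvg (u i) (k i)) ->
  ccvg (fun n => \sum_(i <- r | P i) u i n) (\sum_(i <- r | P i) k i).
Proof.
move=> uk; elim: r => [|i r IH].
  by rewrite big_nil; under eq_fun do rewrite big_nil; exact: ccvg_cst.
rewrite big_cons; under eq_fun do rewrite big_cons.
by case: (P i) => //; exact: ccvgD.
Qed.

Lemma ccvg_prod (I : Type) (r : seq I) (P : pred I) (u : I -> nat -> C) (k : I -> C) :
  (forall i, ccvg (u i) (k i)) ->
  ccvg (fun n => \prod_(i <- r | P i) u i n) (\prod_(i <- r | P i) k i).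
Proof.
move=> uk; elim: r => [|i r IH].
  by rewrite big_nil; under eq_fun do rewrite big_nil; exact: ccvg_cst.
rewrite big_cons; under eq_fun do rewrite big_cons.
by case: (P i) => //; exact: ccvgM.
Qed.

Lemma ccvg_det n (u : nat -> 'M[C]_n) (k : 'M[C]_n) :
  (forall i j, ccvg (fun N => u N i j) (k i j)) -> ccvg (fun N => \det (u N)) (\det k).
Proof.
move=> uk; apply: ccvg_sum => s; apply: ccvgM; first exact: ccvg_cst.
by apply: ccvg_prod => i.
Qed.

(** In the order on complex numbers, [0 <= k] also says that [k] is real: the imaginary parts are
    eventually 0, hence so is their limit. *)
Lemma ccvg_ge0 u k N0 : (forall N, (N0 <= N)%N -> 0 <= u N) -> ccvg u k -> 0 <= k.
Proof.
move=> u0 [u1 u2]; rewrite lecE /=; apply/andP; split.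
  apply/eqP; have <- : limn (fun n => complex.Im (u n)) = complex.Im k by exact/cvg_lim.
  apply: cvg_lim => //; apply: cvg_near_cst; near=> n.
  by apply: ger0_Im; apply: u0; near: n; exists N0.
have <- : limn (fun n => complex.Re (u n)) = complex.Re k by exact/cvg_lim.
apply: limr_ge; first by apply/cvg_ex; exists (complex.Re k).
near=> n; have : 0 <= u n by apply: u0; near: n; exists N0.
by rewrite lecE => /andP[].
Unshelve. all: by end_near. Qed.

Lemma ccvg_csum d (a : freq d -> C) (B : R) :
  (forall N, csum N (fun k => normc (a k)) <= B) ->
  ccvg (fun N => csum N a)
    (limn (fun N => complex.Re (csum N a)) +i* limn (fun N => complex.Im (csum N a)))%C.
Proof.
move=> aB.
have ReE N : complex.Re (csum N a) = csum N (fun k => complex.Re (a k)).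
  exact: (big_morph (@complex.Re R) ReD erefl).
have ImE N : complex.Im (csum N a) = csum N (fun k => complex.Im (a k)).
  exact: (big_morph (@complex.Im R) ImD erefl).
split => /=.
  under eq_fun do rewrite ReE; apply: (csum_abs_cvg (B := B)) => N.
  apply: le_trans (aB N); apply: ler_sum => j _; exact: normc_ge_absRe.
under eq_fun do rewrite ImE; apply: (csum_abs_cvg (B := B)) => N.
apply: le_trans (aB N); apply: ler_sum => j _; exact: normc_ge_absIm.
Qed.

End ComplexLimits.

(** * Sampling and approximation numbers *)

(** Each of the [m] factors of the falling factorial of [2m] is at least [m], and that factorial
    equals [m!] times a binomial coefficient at most [2^(2m)]. *)
Lemma expnn_le_fact m : (m ^ m <= 4 ^ m * m`!)%N.
Proof.
have bin_le n k : ('C(n, k) <= 2 ^ n)%N.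
  case: (leqP k n) => [kn|nk]; last by rewrite bin_small.
  rewrite -[2%N]/(1 + 1)%N expnDn (bigD1 (Ordinal (kn : (k < n.+1)%N))) //= !exp1n !muln1.
  exact: leq_addr.
apply: (@leq_trans ((m + m) ^_ m)).
  rewrite ffact_prod -[X in (_ ^ X <= _)%N]card_ord -prod_nat_const.
  by apply: leq_prod => i _; have := ltn_ord i; lia.
by rewrite -bin_ffact leq_mul2r (leq_trans (bin_le _ _)) ?orbT // addnn -mul2n expnM.
Qed.

Section Sampling.
Local Open Scope complex_scope.
Variables (R : realType) (d : nat) (w : freq d -> R).
Local Notation C := R[i].
Local Notation normc := ComplexField.Normc.normc.
Local Notation cube N := {ffun 'I_d -> 'I_(2 * N).+1}.
Hypothesis w_gt0 : forall k, 0 < w k.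

Definition lam (k : freq d) : R := (w k) ^- 2.
Definition hnorm (c : coefs R d) (k : freq d) : R := (normc (c k)) ^+ 2 * (w k) ^+ 2.
Definition feat (x : pt R d) (k : freq d) : C := (w k)^-1%:C * ek k x.

Lemma normc_normr (z : C) : `|z| = (normc z)%:C.
Proof. by []. Qed.

Lemma normc_ge0 (z : C) : 0 <= normc z.
Proof. by case: z => a b; exact: sqrtr_ge0. Qed.

Lemma normcE (z : C) (r : R) : `|z| = r%:C -> normc z = r.
Proof. by rewrite normc_normr => -[]. Qed.

Lemma normc_ek (k : freq d) (x : pt R d) : normc (ek k x) = 1.
Proof. exact/normcE/norm_ek. Qed.

Lemma lam_gt0 k : 0 < lam k.
Proof. by rewrite invr_gt0 exprn_gt0. Qed.

Lemma hnorm_ge0 c k : 0 <= hnorm c k.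
Proof. by rewrite mulr_ge0 // sqr_ge0. Qed.

Lemma Hnorm2_leP c (B : R) : (Hnorm2 w c <= B%:E)%E <-> forall N, csum N (hnorm c) <= B.
Proof. exact: (esum_leP B (hnorm_ge0 c)). Qed.

(** The bound (p + q)^2 <= 2 p^2 + 2 q^2. It is sharp enough to keep half the difference of two
    elements of the unit ball inside the ball. *)
Lemma normc_lin2 (a b u v : C) :
  normc (a * u + b * v) ^+ 2 <= 2 * normc a ^+ 2 * normc u ^+ 2 + 2 * normc b ^+ 2 * normc v ^+ 2.
Proof.
have H : normc (a * u + b * v) <= normc a * normc u + normc b * normc v.
  rewrite -lecR rmorphD !rmorphM /= -!normc_normr -!normrM; exact: ler_normD.
have := normc_ge0 (a * u + b * v).
have : 0 <= normc a * normc u by rewrite mulr_ge0 ?normc_ge0.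
have : 0 <= normc b * normc v by rewrite mulr_ge0 ?normc_ge0.
move: H; set p := normc a * _; set q := normc b * _; set r := normc _ => H q0 p0 r0.
have -> : 2 * normc a ^+ 2 * normc u ^+ 2 = 2 * p ^+ 2 by rewrite /p; ring.
have -> : 2 * normc b ^+ 2 * normc v ^+ 2 = 2 * q ^+ 2 by rewrite /q; ring.
have := sqr_ge0 (p - q); nra.
Qed.

Lemma csum_hnorm_lin (a b : C) (f g : coefs R d) (A B : R) N :
  (csum N (hnorm f) <= A) -> (csum N (hnorm g) <= B) ->
  csum N (hnorm (fun k => a * f k + b * g k)) <=
  2 * normc a ^+ 2 * A + 2 * normc b ^+ 2 * B.
Proof.
move=> fA gB.
apply: (@le_trans _ _ (2 * normc a ^+ 2 * csum N (hnorm f) + 2 * normc b ^+ 2 * csum N (hnorm g))).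
  rewrite /csum !mulr_sumr -big_split /=; apply: ler_sum => j _.
  set k := cube_freq j; have := ler_wpM2r (sqr_ge0 (w k)) (normc_lin2 a b (f k) (g k)).
  by rewrite /hnorm; lra.
by rewrite lerD // ler_wpM2l // mulr_ge0 // sqr_ge0.
Qed.

Lemma HwP c : Hw w c <-> exists B, forall N, csum N (hnorm c) <= B.
Proof.
split=> [cfin|[B /Hnorm2_leP cB]]; last exact: le_lt_trans cB (ltry _).
exists (fine (Hnorm2 w c)); apply/Hnorm2_leP; rewrite fineK // ge0_fin_numE //.
by apply: esum_ge0 => k _; rewrite lee_fin hnorm_ge0.
Qed.

Lemma Hw_lin (a b : C) f g : Hw w f -> Hw w g -> Hw w (fun k => a * f k + b * g k).
Proof.
move=> /HwP[A fA] /HwP[B gB]; apply/HwP; eexists => N.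
exact: csum_hnorm_lin.
Qed.

Lemma fvalE (c : coefs R d) x l : ccvg (fun N => psum c x N) l -> fval c x = l.
Proof.
move=> [h1 h2]; rewrite /fval (cvg_lim _ h1) // (cvg_lim _ h2) //.
by case: (l).
Qed.

Lemma ccvg_near (u : nat -> C) l N0 : (forall N, (N0 <= N)%N -> u N = l) -> ccvg u l.
Proof.
move=> ul; split; apply: cvg_near_cst; near=> n; congr (_ _); apply: ul; near: n; exists N0 => //.
Unshelve. all: by end_near. Qed.

Variable Lam : R.
Hypothesis LamP : forall N, csum N lam <= Lam.

Lemma ccvg_psum c x : Hw w c -> ccvg (fun N => psum c x N) (fval c x).
Proof.
move=> /HwP[B cB]; apply: (ccvg_csum (a := fun k => c k * ek k x) (B := B + Lam)) => N.
apply: le_trans (lerD (cB N) (LamP N)); rewrite -big_split /=; apply: ler_sum => j _.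
rewrite ComplexField.Normc.normcM normc_ek mulr1 /hnorm /lam.
set k := cube_freq j; have w0 := w_gt0 k.
(* Absolute convergence from [p q <= p^2 + q^2], whose right-hand side sums to at most [B + Lam]. *)
pose p := normc (c k) * w k; pose q := (w k)^-1.
have -> : normc (c k) = p * q by rewrite /p /q mulfK ?gt_eqF.
have -> : (p * q) ^+ 2 * w k ^+ 2 = p ^+ 2.
  by rewrite -exprMn /q -mulrA mulVf ?mulr1 ?gt_eqF.
rewrite -exprVn -/q; have := sqr_ge0 (p - q); have := sqr_ge0 p; have := sqr_ge0 q; nra.
Qed.

Lemma fval_lin (a b : C) f g x : Hw w f -> Hw w g ->
  fval (fun k => a * f k + b * g k) x = a * fval f x + b * fval g x.
Proof.
move=> wf wg; apply: fvalE.
have -> : (fun N => psum (fun k => a * f k + b * g k) x N) =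
   (fun N => a * psum f x N + b * psum g x N).
  apply/funext => N; rewrite /psum !mulr_sumr -big_split; apply: eq_bigr => j _ /=; ring.
by apply: ccvgD; (apply: ccvgM; [exact: ccvg_cst|exact: ccvg_psum]).
Qed.

(** * Kernel determinants as limits of truncated Gram determinants *)

Definition gramN N n (X : nat -> pt R d) : 'M[C]_n :=
  gram (fun (i : 'I_n) (j : cube N) => feat (X i) (cube_freq j)).

Definition kern (x y : pt R d) : C :=
  limn (fun N => complex.Re (csum N (fun k => feat x k * Num.conj (feat y k)))) +i*
  limn (fun N => complex.Im (csum N (fun k => feat x k * Num.conj (feat y k)))).

Definition kerndet n (X : nat -> pt R d) : C := \det (\matrix_(i < n, j < n) kern (X i) (X j)).

Lemma norm_realC (r : R) : 0 <= r -> `|r%:C| = r%:C.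
Proof. by move=> r0; rewrite ger0_norm // ler0c. Qed.

Lemma norm_feat x k : `|feat x k| = (w k)^-1%:C.
Proof. by rewrite normrM norm_ek mulr1 norm_realC // invr_ge0 ltW. Qed.

Lemma ccvg_gramN n X (i j : 'I_n) : ccvg (fun N => gramN N n X i j) (kern (X i) (X j)).
Proof.
under eq_fun do rewrite mxE.
apply: (ccvg_csum (a := fun k => feat (X i) k * Num.conj (feat (X j) k)) (B := Lam)) => N.
apply: le_trans (LamP N); apply: ler_sum => l _.
rewrite (@normcE _ (lam (cube_freq l))) // normrM norm_conjC !norm_feat.
by rewrite -rmorphM -expr2 exprVn.
Qed.

(** By Cauchy-Binet both sides are sums of squared minors, and those of the small cube occur among
    those of the large one. *)
Lemma det_gramN_mono n X N N' : (N <= N')%N -> \det (gramN N n X) <= \det (gramN N' n X).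
Proof.
move=> NN'; have [h hinj hE] := @cube_freq_widen d _ _ NN'.
have fact0 : (0 : C) < n`!%:R by rewrite ltr0n fact_gt0.
rewrite -(ler_pM2l fact0) -!cauchy_binet_gram.
pose hf (f : {ffun 'I_n -> cube N}) : {ffun 'I_n -> cube N'} := [ffun i => h (f i)].
have hfinj : injective hf.
  by move=> f g /ffunP fg; apply/ffunP => i; apply: hinj; have := fg i; rewrite !ffunE.
apply: le_trans (ler_sum_inj hfinj _) => [|f]; last by rewrite exprn_ge0.
apply: ler_sum => f _; rewrite le_eqVlt; apply/orP; left; apply/eqP.
congr (`|\det _| ^+ 2); apply/matrixP => i j.
by rewrite !mxE /hf ffunE hE.
Qed.

Lemma ccvg_kerndet n X : ccvg (fun N => \det (gramN N n X)) (kerndet n X).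
Proof. by apply: ccvg_det => i j; rewrite mxE; exact: ccvg_gramN. Qed.

Lemma det_gramN_le_kerndet n X N : \det (gramN N n X) <= kerndet n X.
Proof.
rewrite -subr_ge0; apply: (ccvg_ge0 (N0 := N)); last first.
  by apply: ccvgB; [exact: ccvg_kerndet|exact: ccvg_cst].
by move=> N' NN'; rewrite subr_ge0 det_gramN_mono.
Qed.

(** Points form a sequence indexed by [nat], so that adding one changes no index type; the new point
    comes first, ready for an expansion along the first row. *)
Definition add_pt (x : pt R d) (X : nat -> pt R d) (i : nat) := if i is j.+1 then X j else x.

(** With b the vector of values of [c], the matrix [H], the kernel matrix minus b times its adjoint,
    has nonnegative determinant, as a limit of the truncated case [det_gram_bessel]. Since [c]
    vanishes on [X], [H] differs from the kernel matrix only in the corner, and the first-row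
    expansion gives the claim. *)
Lemma kerndet_add n X c x : (forall N, csum N (hnorm c) <= 1) ->
  (forall i, (i < n)%N -> fval c (X i) = 0) ->
  `|fval c x| ^+ 2 * kerndet n X <= kerndet n.+1 (add_pt x X).
Proof.
move=> c1 cX; pose Y := add_pt x X.
have wc : Hw w c by apply/HwP; exists 1.
pose H : 'M[C]_n.+1 := \matrix_(i, j) (kern (Y i) (Y j) - fval c (Y i) * Num.conj (fval c (Y j))).
have H0 : 0 <= \det H.
  apply: (ccvg_ge0 (N0 := 0) (u := fun N => \det (\matrix_(i, j) (gramN N n.+1 Y i j -
    psum c (Y i) N * Num.conj (psum c (Y j) N))))); last first.
    apply: ccvg_det => i j; under eq_fun do rewrite mxE; rewrite mxE.
    apply: ccvgB; first exact: ccvg_gramN.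
    by apply: ccvgM; [|apply: ccvg_conj]; exact: ccvg_psum.
  move=> N _.
  (* Rescaling by [w] puts the coefficients in the unit ball of l^2, and values of the partial sums
     become pairings with [feat]. *)
  pose y (j : cube N) : C := c (cube_freq j) * (w (cube_freq j))%:C.
  have yE i : psum c (Y i) N = \sum_j feat (Y i) (cube_freq j) * y j.
    apply: eq_bigr => j _; rewrite /feat /y.
    have wn : (w (cube_freq j))%:C != 0 :> C by rewrite eq_complex /= gt_eqF.
    rewrite fmorphV; field.
    exact: wn.
  under eq_mx => i j do rewrite !yE.
  apply: det_gram_bessel.
  have -> : \sum_j `|y j| ^+ 2 = (csum N (hnorm c))%:C.
    rewrite rmorph_sum; apply: eq_bigr => j _ /=.
    by rewrite normrM exprMn norm_realC ?ltW // normc_normr -!rmorphXn -rmorphM.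
  by rewrite -[1]/(1%:C) lecR.
pose K : 'M[C]_n.+1 := \matrix_(i, j) kern (Y i) (Y j).
have rowHK : row' ord0 H = row' ord0 K.
  apply/matrixP => i j; rewrite !mxE; have -> : fval c (Y (lift ord0 i)) = 0 by exact: cX.
  by rewrite mul0r subr0.
have cofHK j : cofactor H ord0 j = cofactor K ord0 j.
  rewrite /cofactor; congr (_ * \det _); apply/matrixP => i k.
  by have := congr1 (fun M : matrix C n n.+1 => M i (lift j k)) rowHK; rewrite !mxE.
have detK : kerndet n.+1 Y = \det K by [].
have cofK : cofactor K ord0 ord0 = kerndet n X.
  rewrite /cofactor expr0 mul1r; congr (\det _).
  by apply/matrixP => i j; rewrite !mxE.
have HK0 j : H ord0 j = K ord0 j - (if j == ord0 then `|fval c x| ^+ 2 else 0).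
  rewrite !mxE normCK; case: (unliftP ord0 j) => [j' ->|->] //=.
  by rewrite cX ?add0n ?ltn_ord // [X in _ - _ * X](_ : _ = 0) ?mulr0 //; exact: rmorph0.
have detH : \det H = \det K - `|fval c x| ^+ 2 * cofactor K ord0 ord0.
  rewrite (expand_det_row H ord0) (expand_det_row K ord0).
  transitivity (\sum_j (K ord0 j * cofactor K ord0 j -
      (if j == ord0 then `|fval c x| ^+ 2 else 0) * cofactor K ord0 j)).
    by apply: eq_bigr => j _; rewrite cofHK HK0 mulrBl.
  rewrite sumrB; congr (_ - _); rewrite (bigD1 ord0) //= big1 ?addr0 // => j j0.
  by rewrite (negbTE j0) mul0r.
by rewrite detK -cofK -subr_ge0 -detH.
Qed.

(** * The sums E_n with frequencies restricted to a cube *)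

Definition cube_injsum N n : R := injsum n (fun j : cube N => lam (cube_freq j)).

Lemma cube_injsumC N n :
  injsum n (fun j : cube N => `|(w (cube_freq j))^-1%:C| ^+ 2) = (cube_injsum N n)%:C.
Proof.
rewrite /cube_injsum /injsum rmorph_sum; apply: eq_bigr => f _ /=.
rewrite rmorph_prod; apply: eq_bigr => i _ /=.
by rewrite norm_realC ?invr_ge0 ?ltW // -rmorphXn /lam exprVn.
Qed.

Lemma cube_injsum_ge0 N n : 0 <= cube_injsum N n.
Proof. by apply: injsum_ge0 => j; rewrite ltW ?lam_gt0. Qed.

Lemma det_gramN_upper N n X :
  n`!%:R * \det (gramN N n X) <= (n%:R ^+ n * cube_injsum N n)%:C.
Proof.
rewrite rmorphM rmorphXn rmorph_nat /= -cube_injsumC.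
by apply: det_gram_le => i t; rewrite norm_ek.
Qed.

Lemma exists_gramN_lower N n : exists X : nat -> pt R d,
  (forall i, torus (X i)) /\ (cube_injsum N n)%:C <= \det (gramN N n X).
Proof.
have cube0 : cube N by exact: [ffun=> ord0].
have [|X XE] := exists_det_gram_ge (@ek_orth R d N) n (fun j => (w (cube_freq j))^-1%:C).
  by apply/card_gt0P; exists cube0.
(* The terms from index [n] on are a fixed grid point, so that the whole sequence lies in the
   torus. *)
exists (fun i => gpt R (if insub i is Some i' then X i' else cube0)); split.
  by move=> i; exact: torus_gpt.
rewrite -cube_injsumC; apply: (le_trans XE); rewrite le_eqVlt; apply/orP; left; apply/eqP.
congr (\det _); apply/matrixP => i j; rewrite !mxE; apply: eq_bigr => t _.
by rewrite !valK.
Qed.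

(** Setting the values on [s] to 0 keeps a tail as a sum over all frequencies, to which the cube
    lemmas apply. *)
Definition off (s : seq (freq d)) (a : freq d -> R) (k : freq d) : R :=
  if k \in s then 0 else a k.

Lemma cube_injsum_succ s N n (tau : R) : csum N (off s lam) <= tau ->
  (n.+1 - size s)%:R * cube_injsum N n.+1 <= n.+1%:R * (tau * cube_injsum N n).
Proof.
move=> stau; have lam0 j : 0 <= lam (@cube_freq d N j) by rewrite ltW ?lam_gt0.
pose S := [pred j : cube N | cube_freq j \in s].
have Ss : (#|S| <= size s)%N.
  rewrite cardE -(size_map (@cube_freq d N)); apply: uniq_leq_size.
    by rewrite map_inj_uniq ?enum_uniq //; exact: cube_freq_inj.
  by move=> k /mapP[j]; rewrite mem_enum => jS ->.
apply: le_trans (injsum_succ_le n lam0 Ss) _.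
rewrite ler_wpM2l // ler_wpM2r ?cube_injsum_ge0 // (le_trans _ stau) //.
by rewrite big_mkcond /=; apply: ler_sum => j _; rewrite inE /off; case: (_ \in s).
Qed.

(** Iterate [cube_injsum_succ] from E_m: going from [m + t] to [m + t + 1] costs the factor
    [tau (m + t + 1) / (t + 1)], and the product of these is a binomial coefficient times a power of
    [tau]. *)
Lemma cube_injsum_double s N m (tau : R) : size s = m -> csum N (off s lam) <= tau ->
  (m`! * m`!)%:R * cube_injsum N (m + m) <= (m + m)`!%:R * (tau ^+ m * cube_injsum N m).
Proof.
move=> sm stau.
have tau0 : 0 <= tau.
  by apply: le_trans stau; apply: sumr_ge0 => j _; rewrite /off; case: ifP => // _; rewrite ltW ?lam_gt0.
suff H t : (t`! * m`!)%:R * cube_injsum N (m + t) <= (m + t)`!%:R * (tau ^+ t * cube_injsum N m).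
  exact: H.
elim: t => [|t IH]; first by rewrite addn0 fact0 mul1n expr0 mul1r.
have := @cube_injsum_succ s N (m + t) tau stau.
rewrite sm -addnS addKn addnS => step.
rewrite !factS exprS.
have -> : (t.+1 * t`! * m`!)%:R * cube_injsum N (m + t).+1 =
    (t`! * m`!)%:R * (t.+1%:R * cube_injsum N (m + t).+1) by rewrite !natrM; ring.
apply: le_trans (ler_wpM2l _ step) _; first exact: ler0n.
have -> : (t`! * m`!)%:R * ((m + t).+1%:R * (tau * cube_injsum N (m + t))) =
    (m + t).+1%:R * tau * ((t`! * m`!)%:R * cube_injsum N (m + t)) by ring.
apply: le_trans (ler_wpM2l _ IH) _; first by rewrite mulr_ge0.
by rewrite natrM; lra.
Qed.

Lemma kerndet_upper s m (tau e : R) X : size s = m -> (forall N, csum N (off s lam) <= tau) ->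
  (forall N, cube_injsum N m <= e) ->
  kerndet (m + m) X <= (64%:R ^+ m * tau ^+ m * e)%:C.
Proof.
move=> sm stau eN.
rewrite -subr_ge0; apply: (ccvg_ge0 (N0 := 0)); last first.
  by apply: ccvgB; [exact: ccvg_cst|exact: ccvg_kerndet].
move=> N _; rewrite subr_ge0.
have fact0 n : (0 : R) < n`!%:R by rewrite ltr0n fact_gt0.
have tau0 : 0 <= tau.
  by apply: le_trans (stau 0); apply: sumr_ge0 => j _; rewrite /off; case: ifP => // _; rewrite ltW ?lam_gt0.
have P0 : (0 : C) < (m`! * m`! * (m + m)`!)%:R by rewrite ltr0n !muln_gt0 !fact_gt0.
rewrite -(ler_pM2l P0) natrM -[leLHS]mulrA -[leRHS]mulrA.
apply: le_trans (ler_wpM2l (ler0n _ _) (det_gramN_upper N (m + m) X)) _.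
rewrite -!(rmorph_nat (real_complex R)) -!rmorphM lecR.
have -> : (m`! * m`!)%:R * ((m + m)%:R ^+ (m + m) * cube_injsum N (m + m)) =
   (m + m)%:R ^+ (m + m) * ((m`! * m`!)%:R * cube_injsum N (m + m)) by ring.
apply: le_trans (ler_wpM2l _ (cube_injsum_double sm (stau N))) _; first by rewrite exprn_ge0.
(* The constant 64: [(2m)^(2m)] is [4^m] times the square of [m^m], and each [m^m] is at most
   [4^m m!]. *)
have nn : ((m + m) ^ (m + m) <= 64 ^ m * (m`! * m`!))%N.
  rewrite expnD addnn -mul2n expnMn (_ : 64 = 2 * 2 * (4 * 4))%N // !expnMn.
  have := expnn_le_fact m; set a := (m ^ m)%N; set b := (4 ^ m)%N; set f := m`!; set g := (2 ^ m)%N => H.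
  by have := leq_mul (leqnn (g * g)) (leq_mul H H); lia.
have nnR : (m + m)%:R ^+ (m + m) <= 64%:R ^+ m * (m`! * m`!)%:R :> R.
  by rewrite -!natrX -natrM ler_nat.
apply: (@le_trans _ _ (64%:R ^+ m * (m`! * m`!)%:R * ((m + m)`!%:R * (tau ^+ m * e)))).
  apply: ler_pM => //.
  - by rewrite !mulr_ge0 ?exprn_ge0 ?cube_injsum_ge0 ?ler0n.
  by rewrite ler_wpM2l // ler_wpM2l ?exprn_ge0.
by rewrite le_eqVlt; apply/orP; left; apply/eqP; ring.
Qed.

Lemma cube_injsum_gt0 N n : (n <= #|{: cube N}|)%N -> 0 < cube_injsum N n.
Proof.
move=> nN; have prod_gt0 (f : {ffun 'I_n -> cube N}) : 0 < \prod_i lam (cube_freq (f i)).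
  by apply: prodr_gt0 => i _; exact: lam_gt0.
pose f : {ffun 'I_n -> cube N} := [ffun i => enum_val (widen_ord nN i)].
have fi : injectiveb f.
  by apply/injectiveP => i j; rewrite !ffunE => /enum_val_inj [] /val_inj.
rewrite /cube_injsum /injsum (bigD1 f) //= ltr_pwDl //.
by apply: sumr_ge0 => g _; rewrite ltW.
Qed.

(** [e] is the supremum over cubes, finite by [Lam ^+ n]; being positive, it is less than twice one
    of the truncated sums. *)
Lemma cube_injsum_sup n : (0 < d)%N ->
  exists N0 e, [/\ 0 < e, (forall N, cube_injsum N n <= e) & e < 2 * cube_injsum N0 n].
Proof.
move=> d0.
(* Positivity needs [n] distinct frequencies, and a single axis of this cube already has
   [2n + 1]. *)
have Nn : (n <= #|{: cube n}|)%N.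
  rewrite card_ffun !card_ord -[X in (X <= _)%N]expn1.
  apply: (@leq_trans ((2 * n).+1 ^ 1)%N); first by rewrite !expn1; lia.
  exact: leq_pexp2l.
have bd N : cube_injsum N n <= Lam ^+ n.
  apply: le_trans (injsum_le_exp n _) _; first by move=> j; rewrite ltW ?lam_gt0.
  apply: lerXn2r; rewrite ?nnegrE; last exact: LamP.
    by apply: sumr_ge0 => j _; rewrite ltW ?lam_gt0.
  apply: le_trans (LamP 0).
  by apply: sumr_ge0 => j _; rewrite ltW ?lam_gt0.
pose E := range (fun N => cube_injsum N n).
have hsE : has_sup E.
  by split; [exists (cube_injsum 0 n); exists 0%N|exists (Lam ^+ n) => _ [N _ <-]].
have supE N : cube_injsum N n <= sup E by apply: sup_ubound; [case: hsE|exists N].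
have E0 : 0 < sup E := lt_le_trans (cube_injsum_gt0 Nn) (supE n).
have [_ [N0 _ <-] N0E] := sup_adherent (divr_gt0 E0 (ltr0Sn R 1)) hsE.
by exists N0, (sup E); split => //; lra.
Qed.

(** * Good sampling points and the error of interpolation *)

Lemma good_points s m (tau : R) : (0 < d)%N -> (0 < m)%N -> size s = m -> 0 < tau ->
  (forall N, csum N (off s lam) <= tau) ->
  exists X : nat -> pt R d, (forall i, torus (X i)) /\
    forall c x, torus x -> (forall N, csum N (hnorm c) <= 1) ->
      (forall i, (i < m + m)%N -> fval c (X i) = 0) ->
      normc (fval c x) ^+ 2 <= 256%:R * tau.
Proof.
move=> d0 m0 sm tau0 stau; apply: contrapT => /forallNP bad.
have [N0 [e [e0 eN eN0]]] := cube_injsum_sup m d0.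
have T0 : 0 <= 256%:R * tau by rewrite mulr_ge0 ?ler0n // ltW.
(* The function supplied by [bad] vanishes at the first [m + m] terms, hence at the [m + t] in use;
   adding the point where it is large gains a factor [256 tau]. *)
have ext t : (t <= m)%N -> exists X : nat -> pt R d, (forall i, torus (X i)) /\
    ((256%:R * tau) ^+ t * cube_injsum N0 m)%:C <= kerndet (m + t) X.
  elim: t => [_|t IH tm].
    have [X [TX XN]] := exists_gramN_lower N0 m; exists X; split => //.
    by rewrite expr0 mul1r addn0 (le_trans XN) // det_gramN_le_kerndet.
  have [X [TX Xt]] := IH (ltnW tm).
  have /not_andP[//|/existsNP[c /existsNP[x /not_implyP[Tx /not_implyP[c1 /not_implyP[cX cx]]]]]] := bad X.
  exists (add_pt x X); split; first by case.
  have J0 : 0 <= (256%:R * tau) ^+ t * cube_injsum N0 m.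
    by rewrite mulr_ge0 ?cube_injsum_ge0 ?exprn_ge0.
  rewrite addnS; apply: le_trans (kerndet_add x c1 _); last first.
    by move=> i im; apply: cX; rewrite (leq_trans im) // leq_add2l ltnW.
  rewrite exprS -mulrA rmorphM /= normc_normr -rmorphXn /=.
  apply: ler_pM => //.
  - by rewrite ler0c; exact: T0.
  - by rewrite ler0c; exact: J0.
  - by rewrite lecR; move/negP: cx; rewrite -ltNge => /ltW.
have [X [_ XE]] := ext m (leqnn m).
have := le_trans XE (kerndet_upper X sm stau eN).
rewrite lecR leNgt => /negP; apply.
(* After cancelling the m-th power of [64 tau], what remains is that [e] is less than
   [4^m * cube_injsum N0 m]; this follows from [eN0] because [m] is positive. *)
rewrite exprMn (_ : 256%:R = 4%:R * 64%:R); last by rewrite -natrM.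
set J := cube_injsum N0 m in eN0 *.
have -> : (4%:R * 64%:R) ^+ m * tau ^+ m * J = (64%:R ^+ m * tau ^+ m) * (4%:R ^+ m * J).
  by rewrite exprMn; ring.
rewrite ltr_pM2l ?mulr_gt0 ?exprn_gt0 // (lt_le_trans eN0) // ler_wpM2r ?cube_injsum_ge0 //.
case: m m0 {sm eN eN0 ext X XE bad J} => // m _.
apply: (@le_trans _ _ (4%:R ^+ 1)); first by rewrite expr1 ler_nat.
by rewrite ler_eXn2l // ltr1n.
Qed.

(** The algorithm returns any element of the unit ball with the observed values. Half its difference
    from the true function lies in the unit ball and vanishes at the points, whence the factor 2. *)
Lemma gn_le n X (T : R) : 0 <= T -> (forall i, torus (X i)) ->
  (forall c x, torus x -> (forall N, csum N (hnorm c) <= 1) ->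
     (forall i, (i < n)%N -> fval c (X i) = 0) -> normc (fval c x) ^+ 2 <= T) ->
  (gn w n <= (2 * Num.sqrt T)%:E)%E.
Proof.
move=> T0 TX XT.
pose P (y : 'I_n -> C) : set (coefs R d) :=
  [set c | (forall N, csum N (hnorm c) <= 1) /\ forall i : 'I_n, fval c (X i) = y i].
(* The default 0 is returned only for data that no element of the unit ball produces. *)
pose phi (y : 'I_n -> C) (x : pt R d) : C := fval (xget (fun=> 0) (P y)) x.
apply: le_trans (ereal_inf_lbound _) _.
  exists (fun (i : 'I_n) c => fval c (X i)), phi; split; last by reflexivity.
  by move=> i; exists (X i).
apply: ge_ereal_sup => _ [c [x [wc /Hnorm2_leP c1 Tx ->]]]; rewrite lee_fin /phi.
set y := fun i : 'I_n => _; have Pc : P y c by split.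
have [c'1 c'X] := xgetPex (fun=> 0) (ex_intro (P y) c Pc).
set c' := xget _ _ in c'1 c'X *.
have wc' : Hw w c' by apply/HwP; exists 1.
pose h : C := (2^-1)%:C.
have nh : normc h = 2^-1 by apply/normcE/norm_realC; rewrite invr_ge0.
have nhN : normc (- h) = 2^-1 by apply/normcE; rewrite normrN normc_normr nh.
have hE z : fval (fun k => h * c k + - h * c' k) z = h * (fval c z - fval c' z).
  by rewrite fval_lin // mulNr mulrBr.
have := XT (fun k => h * c k + - h * c' k) x Tx.
rewrite hE ComplexField.Normc.normcM nh => H.
have {}H : (2^-1 * normc (fval c x - fval c' x)) ^+ 2 <= T.
  apply: H => [N|i ni].
    apply: le_trans (csum_hnorm_lin h (- h) (c1 N) (c'1 N)) _.
    by rewrite nh nhN; lra.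
  by rewrite hE (c'X (Ordinal ni)) subrr mulr0.
have : 2^-1 * normc (fval c x - fval c' x) <= Num.sqrt T.
  rewrite -[leLHS]ger0_norm; last by rewrite mulr_ge0 ?normc_ge0 // invr_ge0.
  by rewrite -sqrtr_sqr ler_wsqrtr.
by lra.
Qed.

(** * Upper bound for approximation numbers by truncated Fourier series *)

Lemma off_ge0 s k : 0 <= off s lam k.
Proof. by rewrite /off; case: ifP => // _; rewrite ltW ?lam_gt0. Qed.

(** Cauchy-Schwarz on the frequencies outside [s], applied to partial sums over cubes that contain
    [s] and then passed to the limit. *)
Lemma fval_sub_le s c x (tau : R) : uniq s -> Hw w c ->
  (forall N, csum N (hnorm c) <= 1) -> (forall N, csum N (off s lam) <= tau) ->
  normc (fval c x - \sum_(k <- s) c k * ek k x) ^+ 2 <= tau.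
Proof.
move=> us wc c1 stau.
have [N0 sN] := seq_cube s.
set v := _ - _.
suff : 0 <= tau%:C - v * Num.conj v.
  by rewrite -normCK normc_normr -rmorphXn subr_ge0 lecR.
apply: (ccvg_ge0 (N0 := N0) (u := fun N => tau%:C -
   (psum c x N - \sum_(k <- s) c k * ek k x) *
   Num.conj (psum c x N - \sum_(k <- s) c k * ek k x))); last first.
  have cv : ccvg (fun N => psum c x N - \sum_(k <- s) c k * ek k x) v.
    by apply: ccvgB; [exact: ccvg_psum|exact: ccvg_cst].
  by apply: ccvgB; [exact: ccvg_cst|apply: ccvgM; [|apply: ccvg_conj]].
move=> N NN0.
have -> : psum c x N - \sum_(k <- s) c k * ek k x =
    \sum_(j : cube N | cube_freq j \notin s) c (cube_freq j) * ek (cube_freq j) x.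
  rewrite /psum (bigID (fun j => cube_freq j \in s)) /= (csum_supp (fun k => c k * ek k x) us); last exact: sN.
  by rewrite addrAC subrr add0r.
rewrite -normCK subr_ge0 normc_normr -rmorphXn lecR.
set S := \sum_(j | _) _.
have : normc S <= \sum_(j : cube N) (normc (c (cube_freq j)) * w (cube_freq j)) *
     (if cube_freq j \in s then 0 else (w (cube_freq j))^-1).
  rewrite -lecR -normc_normr (le_trans (ler_norm_sum _ _ _)) // rmorph_sum /= big_mkcond /=.
  apply: ler_sum => j _; case: ifP => js /=; last first.
    by rewrite (negbFE js) mulr0.
  rewrite (negbTE js) mulfK ?gt_eqF // normrM norm_ek mulr1.
  by [].
move=> nS; have := cauchy_schwarz (fun j : cube N => normc (c (cube_freq j)) * w (cube_freq j))
  (fun j => if cube_freq j \in s then 0 else (w (cube_freq j))^-1).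
have -> : \sum_(j : cube N) (normc (c (cube_freq j)) * w (cube_freq j)) ^+ 2 = csum N (hnorm c).
  by apply: eq_bigr => j _; rewrite exprMn.
have -> : \sum_(j : cube N) (if cube_freq j \in s then 0 else (w (cube_freq j))^-1) ^+ 2 =
   csum N (off s lam).
  by apply: eq_bigr => j _; rewrite /off; case: ifP => _; rewrite ?expr0n // exprVn.
move=> CS; apply: le_trans (_ : _ <= csum N (hnorm c) * csum N (off s lam)) _.
  by apply: le_trans CS; rewrite lerXn2r ?nnegrE ?normc_ge0 // (le_trans _ nS) ?normc_ge0.
rewrite -[leRHS]mul1r ler_pM //; apply: sumr_ge0 => j _; [exact: hnorm_ge0|exact: off_ge0].
Qed.

Lemma an1_le s m (tau : R) : size s = m -> uniq s -> 
  (forall N, csum N (off s lam) <= tau) -> (an1 w m <= (Num.sqrt tau)%:E)%E.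
Proof.
move=> sm us stau.
pose k0 : freq d := fun=> 0.
pose phi (y : 'I_m -> C) (x : pt R d) : C := \sum_(i < m) y i * ek (nth k0 s i) x.
apply: le_trans (ereal_inf_lbound _) _.
  exists (fun (i : 'I_m) c => c (nth k0 s i)), phi; split; last by reflexivity.
  move=> i; split=> // f _ eps eps0; set k := nth k0 s i.
  (* The functional reading off coefficient [k] has norm [1 / w k]. *)
  exists (eps * w k); first by rewrite mulr_gt0.
  move=> g _ gf; have : hnorm (fun k => g k - f k) k < (eps * w k) ^+ 2.
    rewrite -lte_fin; apply: le_lt_trans gf; rewrite /Hnorm2.
    rewrite -(esum_set1 (a := fun k => (hnorm (fun k => g k - f k) k)%:E)) ?lee_fin ?hnorm_ge0 //.
    by apply: esum_subset => // l; rewrite lee_fin hnorm_ge0.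
  rewrite /hnorm -exprMn ltr_pXn2r ?nnegrE ?mulr_ge0 ?normc_ge0 ?ltW //.
  by rewrite ltr_pM2r.
apply: ge_ereal_sup => _ [c [x [wc /Hnorm2_leP c1 Tx ->]]]; rewrite lee_fin.
have -> : phi (fun i => c (nth k0 s i)) x = \sum_(k <- s) c k * ek k x.
  by rewrite (big_nth k0) big_mkord sm.
by rewrite -[leLHS]ger0_norm ?normc_ge0 // -sqrtr_sqr ler_wsqrtr // fval_sub_le.
Qed.

(** * Lower bound for approximation numbers by fooling functions *)

Definition basis_fun (k l : freq d) : C := if l == k then (w k)^-1%:C else 0.

Lemma Hnorm2_supp (c : coefs R d) N : (forall k, ~ range (@cube_freq d N) k -> c k = 0) ->
  Hnorm2 w c = (csum N (hnorm c))%:E.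
Proof.
move=> c0; rewrite -esum_cube; last exact: hnorm_ge0.
rewrite [RHS]esum_mkcond; apply: eq_esum => k _; case: ifPn => // /negP kN.
rewrite c0 ?ComplexField.Normc.normc0 ?expr0n ?mul0r // => kr.
by apply: kN; rewrite inE.
Qed.

Lemma fval_supp (c : coefs R d) N x : (forall k, ~ range (@cube_freq d N) k -> c k = 0) ->
  fval c x = psum c x N.
Proof.
move=> c0; apply: fvalE; apply: (ccvg_near (N0 := N)) => N' NN'.
pose s := [seq @cube_freq d N j | j <- index_enum _].
have us : uniq s by rewrite map_inj_uniq ?index_enum_uniq //; exact: cube_freq_inj.
rewrite /psum (bigID (fun j => cube_freq j \in s)) /= [X in _ + X]big1 ?addr0 => [|j js].
  rewrite (csum_supp (fun k => c k * ek k x) us) ?big_map // => k /mapP[j _ ->].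
  by apply: cube_freq_surj => i; rewrite (leq_trans (absz_cube_freq j i)).
rewrite c0 ?mul0r // => -[l _ lj]; move/negP: js; apply.
by rewrite -lj; apply: map_f; rewrite mem_index_enum.
Qed.

Lemma Hw_supp (c : coefs R d) N : (forall k, ~ range (@cube_freq d N) k -> c k = 0) -> Hw w c.
Proof. by move=> c0; rewrite /Hw /= (Hnorm2_supp c0) ltry. Qed.

(** Both [c] and its negative produce zero data and get the same answer [p], so one of the two
    errors is at least the modulus of the value at [x]. *)
Lemma wc_err_ge m (L : 'I_m -> coefs R d -> C) phi c x :
  (forall i, Lall w (L i)) -> Hw w c -> (Hnorm2 w c <= 1)%E -> torus x ->
  (forall i, L i c = 0) -> ((normc (fval c x))%:E <= wc_err w L phi)%E.
Proof.
move=> LA wc c1 Tx Lc0.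
(* The negative of [c], written in the two-term form in which [Lall] states linearity. *)
pose c' : coefs R d := fun k => -1 * c k + 0 * c k.
have wc' : Hw w c' by exact: Hw_lin.
have c'1 : (Hnorm2 w c' <= 1)%E.
  apply: le_trans c1; apply: le_esum => k _; rewrite lee_fin /c' mul0r addr0 mulN1r.
  rewrite (_ : normc (- c k) = normc (c k)) //.
  by apply/normcE; rewrite normrN.
have Lc'0 i : L i c' = 0 by rewrite (LA i).1 // Lc0 !mulr0 addr0.
have fc' : fval c' x = - fval c x by rewrite fval_lin // mul0r addr0 mulN1r.
pose p := phi (fun=> 0) x.
have ub b : Hw w b -> (Hnorm2 w b <= 1)%E -> (forall i, L i b = 0) ->
    ((normc (fval b x - p))%:E <= wc_err w L phi)%E.
  move=> wb b1 Lb; apply: ereal_sup_ubound; exists b, x; split => //.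
  by congr (normc (_ - phi _ x))%:E; apply/funext.
have [H|H] := leP (normc (fval c x)) (normc (fval c x - p)).
  by apply: le_trans (ub c wc c1 Lc0); rewrite lee_fin.
apply: le_trans (ub c' wc' c'1 Lc'0); rewrite lee_fin fc'.
rewrite (_ : normc (- fval c x - p) = normc (fval c x + p)); last first.
  by apply/normcE; rewrite -opprD normrN.
have : normc (2 * fval c x) <= normc (fval c x - p) + normc (fval c x + p).
  have := ler_normD (fval c x - p) (fval c x + p).
  rewrite (_ : _ + (fval c x + p) = 2 * fval c x); last by ring.
  by rewrite !normc_normr -rmorphD lecR.
rewrite ComplexField.Normc.normcM (_ : normc 2 = 2); first by lra.
by apply/normcE; rewrite normr_nat (rmorph_nat (real_complex R)).
Qed.

(** On trigonometric polynomials with frequencies in the cube, the [m] functionals are given by a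
    matrix. [exists_kernel_peak] yields a unit vector in its kernel that is large at a grid
    point. *)
Lemma wc_err_kernel_ge s m (th : R) N (L : 'I_m -> coefs R d -> C) phi :
  uniq s -> size s = m -> 0 <= th ->
  (forall k, k \in s -> th <= lam k) -> (forall k, k \notin s -> lam k <= th) ->
  (forall k, k \in s -> exists j : cube N, cube_freq j = k) ->
  (forall i, Lall w (L i)) ->
  ((Num.sqrt (csum N (off s lam)))%:E <= wc_err w L phi)%E.
Proof.
move=> us sm th0 ths thsc sN LA.
pose S := [pred j : cube N | cube_freq j \in s].
pose a (j : cube N) : C := (w (cube_freq j))^-1%:C.
have a2 j : `|a j| ^+ 2 = (lam (cube_freq j))%:C.
  by rewrite norm_realC ?invr_ge0 ?ltW // -rmorphXn /lam exprVn.
have Sm : (m <= #|S|)%N.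
  rewrite -sm cardE -(size_map (@cube_freq d N)); apply: uniq_leq_size => // k ks.
  by have [j jk] := sN k ks; apply/mapP; exists j; rewrite // mem_enum inE jk.
have [||t tS|t tS|g [z [z1 zL zv]]] := exists_kernel_peak (@ek_orth R d N)
    (fun j i => L i (basis_fun (cube_freq j))) (a := a) _ Sm (th := th%:C).
- by apply/card_gt0P; exists [ffun=> ord0].
- by rewrite ler0c.
- by rewrite a2 lecR ths.
- by rewrite a2 lecR thsc.
pose c : coefs R d := fun k => \sum_j z j * basis_fun (cube_freq j) k.
have bsupp (j : cube N) k : ~ range (@cube_freq d N) k -> basis_fun (cube_freq j) k = 0.
  by rewrite /basis_fun; case: eqP => // -> []; exists j.
have csupp k : ~ range (@cube_freq d N) k -> c k = 0.
  by move=> kN; rewrite /c big1 // => j _; rewrite bsupp // mulr0.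
have cE (j : cube N) : c (cube_freq j) = z j * a j.
  rewrite /c (bigD1 j) //= {1}/basis_fun eqxx big1 ?addr0 // => l lj.
  by rewrite /basis_fun (inj_eq (@cube_freq_inj d N)) eq_sym (negbTE lj) mulr0.
have Lc i : L i c = 0.
  rewrite -[RHS](zL i) /c.
  (* Linearity is available only for two elements of the space, so membership is carried through the
     induction along with the value. *)
  suff /(_ (index_enum _)) [] : forall r : seq (cube N),
      Hw w (fun k => \sum_(j <- r) z j * basis_fun (cube_freq j) k) /\
      L i (fun k => \sum_(j <- r) z j * basis_fun (cube_freq j) k) =
      \sum_(j <- r) z j * L i (basis_fun (cube_freq j)) by [].
  have wb (j : cube N) : Hw w (basis_fun (cube_freq j)) by exact: (Hw_supp (bsupp j)).
  have w0 : Hw w (fun=> 0) by exact: (@Hw_supp _ N).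
  elim=> [|j r [wr Lr]].
    have -> : (fun k => \sum_(j <- [::]) z j * basis_fun (@cube_freq d N j) k) = fun=> 0.
      by apply/funext => k; rewrite big_nil.
    split => //; rewrite big_nil.
    have -> : (fun=> 0) = (fun k : freq d => 0 * (fun=> 0) k + 0 * (fun=> 0) k) :> coefs R d.
      by apply/funext => k; rewrite mul0r addr0.
    by rewrite (LA i).1 // !mul0r addr0.
  have -> : (fun k => \sum_(j <- j :: r) z j * basis_fun (@cube_freq d N j) k) =
    fun k => z j * basis_fun (cube_freq j) k +
             1 * (\sum_(j <- r) z j * basis_fun (@cube_freq d N j) k).
    by apply/funext => k; rewrite big_cons mul1r.
  by split; [exact: Hw_lin|rewrite (LA i).1 // Lr mul1r big_cons].
have c1 : (Hnorm2 w c <= 1)%E.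
  rewrite (Hnorm2_supp csupp) lee_fin -lecR; apply: le_trans z1.
  rewrite rmorph_sum le_eqVlt; apply/orP; left; apply/eqP; apply: eq_bigr => j _ /=.
  have na : normc (a j) = (w (cube_freq j))^-1.
    by apply/normcE/norm_realC; rewrite invr_ge0 ltW.
  rewrite /hnorm cE ComplexField.Normc.normcM na exprMn -mulrA -exprMn mulVf ?gt_eqF //.
  by rewrite expr1n mulr1 rmorphXn.
apply: le_trans (wc_err_ge phi LA (Hw_supp csupp) c1 (@torus_gpt R d N g) Lc).
rewrite lee_fin -[leRHS]ger0_norm ?normc_ge0 // -sqrtr_sqr ler_wsqrtr // -lecR.
rewrite rmorphXn -[X in X ^+ 2](normc_normr (fval c (gpt R g))) (fval_supp _ csupp).
have -> : psum c (gpt R g) N = \sum_t z t * (a t * ek (cube_freq t) (gpt R g)).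
  by apply: eq_bigr => j _; rewrite cE mulrA.
apply: le_trans zv; rewrite rmorph_sum [leRHS]big_mkcond /=; apply: ler_sum => j _.
by rewrite a2 inE /off; case: (_ \in s).
Qed.

Lemma an1_ge s m (th tau : R) :
  uniq s -> size s = m -> 0 <= th ->
  (forall k, k \in s -> th <= lam k) -> (forall k, k \notin s -> lam k <= th) ->
  (tau%:E <= \esum_(k in [set: freq d]) (off s lam k)%:E)%E ->
  ((Num.sqrt tau)%:E <= an1 w m)%E.
Proof.
move=> us sm th0 ths thsc tauE; apply: le_ereal_inf_tmp => _ [L [phi [LA ->]]].
have [N0 sN] := seq_cube s.
have HN N : (N0 <= N)%N -> ((Num.sqrt (csum N (off s lam)))%:E <= wc_err w L phi)%E.
  by move=> NN0; apply: (wc_err_kernel_ge phi us sm th0) => //; exact: sN.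
(* Only a finite error needs work: minus infinity contradicts the bound at [N0]. *)
move: (wc_err w L phi) HN => [r||] HN; last 2 first.
- by rewrite leey.
- by have := HN N0 (leqnn _).
have r0 : 0 <= r by have := HN N0 (leqnn _); rewrite lee_fin; apply: le_trans; exact: sqrtr_ge0.
rewrite lee_fin -[leRHS]ger0_norm // -sqrtr_sqr ler_wsqrtr // -lee_fin (le_trans tauE) //.
apply/(esum_leP _ (off_ge0 s)) => N.
apply: (@le_trans _ _ (csum (maxn N N0) (off s lam))).
  by apply: csum_mono; [exact: off_ge0|exact: leq_maxl].
have := HN _ (leq_maxr N N0); rewrite lee_fin => H.
have c0 : 0 <= csum (maxn N N0) (off s lam) by apply: sumr_ge0 => j _; exact: off_ge0.
by rewrite -[leLHS]sqr_sqrtr // lerXn2r // nnegrE sqrtr_ge0.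
Qed.

(** * Frequencies with the largest values of [lam] *)

Lemma exists_notin (s : seq (freq d)) : (0 < d)%N -> exists k, k \notin s.
Proof.
move=> d0; have [N sN] := seq_cube s; pose k : freq d := fun=> N.+1%:Z.
exists k; apply/negP => ks; have [j jk] := sN N (leqnn _) k ks.
by have := absz_cube_freq j (Ordinal d0); rewrite jk /= ltnn.
Qed.

(** By summability only finitely many frequencies reach the value at a given [k0] outside [s], so
    the maximum is taken over a finite cube. *)
Lemma exists_max_notin (s : seq (freq d)) : (0 < d)%N ->
  exists l, l \notin s /\ forall k, k \notin s -> lam k <= lam l.
Proof.
move=> d0; have [k0 k0s] := exists_notin s d0.
have lam0 k : 0 <= lam k by rewrite ltW ?lam_gt0.
(* The cube sum is chosen within [lam k0] of the supremum; a frequency outside that cube with value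
   at least [lam k0] would push a larger cube sum past the supremum. *)
have [N NLam] : exists N, forall k, lam k0 <= lam k -> exists j : cube N, cube_freq j = k.
  pose S := range (fun N => csum N lam).
  have hsS : has_sup S.
    by split; [exists (csum 0 lam); exists 0%N|exists Lam => _ [N _ <-]].
  have [_ [N _ <-] NS] := sup_adherent (lam_gt0 k0) hsS.
  exists N => k k0k; apply: contrapT => kN.
  have [N1 kN1] := seq_cube [:: k].
  have [j jk] := kN1 _ (leq_maxr N N1) k (mem_head _ _).
  have [h hinj hE] := @cube_freq_widen d _ _ (leq_maxl N N1).
  have : csum (maxn N N1) lam <= sup S by apply: sup_ubound; [case: hsS|exists (maxn N N1)].
  have : csum N lam + lam k <= csum (maxn N N1) lam.
    rewrite /csum [leRHS](bigD1 j) //= jk addrC lerD2l.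
    under eq_bigr do rewrite -hE.
    rewrite -(big_imset (h := h) (A := predT) (fun j => lam (cube_freq j))) /=; last first.
      by move=> ? ? _ _ /hinj.
    rewrite big_mkcond [leRHS]big_mkcond /=; apply: ler_sum => l _.
    case: ifPn => [/imsetP[i _ ->]|_]; last by case: ifP.
    by case: eqP => // hij; exfalso; apply: kN; exists i; rewrite -hE hij.
  by lra.
have [j0 j0E] := NLam k0 (lexx _).
have j0s : cube_freq j0 \notin s by rewrite j0E.
case: (@arg_maxP _ _ _ j0 [pred j | cube_freq j \notin s] (fun j => lam (cube_freq j)) j0s) => j js jmax.
exists (cube_freq j); split=> // k ks.
have [/NLam[i iE]|] := leP (lam k0) (lam k); first by rewrite -iE; apply: jmax; rewrite /= iE.
by move=> /ltW kk0; rewrite (le_trans kk0) // -j0E; exact: jmax.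
Qed.

Lemma exists_top_freqs m : (0 < d)%N -> exists s : seq (freq d),
  [/\ uniq s, size s = m & forall k l, k \in s -> l \notin s -> lam l <= lam k].
Proof.
move=> d0; elim: m => [|m [s [us sm stop]]]; first by exists [::].
have [k [ks kmax]] := exists_max_notin s d0.
exists (k :: s); split; rewrite /= ?ks ?sm // => i l.
rewrite !inE negb_or => /orP[/eqP ->|iss] /andP[_ ls]; first exact: kmax.
exact: stop.
Qed.

Lemma an1E s m (tau : R) : (0 < d)%N -> uniq s -> size s = m ->
  (forall k l, k \in s -> l \notin s -> lam l <= lam k) ->
  (\esum_(k in [set: freq d]) (off s lam k)%:E = tau%:E)%E ->
  an1 w m = (Num.sqrt tau)%:E.
Proof.
move=> d0 us sm stop tauE; have [l [ls lmax]] := exists_max_notin s d0.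
apply/eqP; rewrite eq_le (an1_le sm us) /=; last by apply/(esum_leP _ (off_ge0 s)); rewrite tauE.
have l0 : 0 <= lam l by rewrite ltW ?lam_gt0.
(* The largest value outside [s] serves as the threshold. *)
by apply: (an1_ge us sm l0 _ lmax); [move=> k ks; exact: stop|rewrite tauE].
Qed.

Lemma gn_an1_le s m (tau : R) : (0 < d)%N -> uniq s -> size s = m ->
  (\esum_(k in [set: freq d]) (off s lam k)%:E = tau%:E)%E ->
  (gn w (2 * m) <= (32%:R * Num.sqrt tau)%:E)%E.
Proof.
move=> d0 us sm tauE.
have stau : forall N, csum N (off s lam) <= tau by apply/(esum_leP _ (off_ge0 s)); rewrite tauE.
have tau0 : 0 < tau.
  have [k ks] := exists_notin s d0.
  have [N /(_ N (leqnn _) k (mem_head _ _)) [j jk]] := seq_cube [:: k].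
  apply: lt_le_trans (stau N); rewrite /csum (bigD1 j) //= jk.
  apply: ltr_pwDl; first by rewrite /off (negbTE ks) lam_gt0.
  by apply: sumr_ge0 => i _; exact: off_ge0.
have T0 : 0 <= 256%:R * tau by rewrite mulr_ge0 ?ler0n // ltW.
(* The factor 2 comes from [gn_le], the 256 from [good_points]. *)
have -> : 32%:R * Num.sqrt tau = 2 * Num.sqrt (256%:R * tau).
  rewrite sqrtrM ?ler0n // (_ : 256%:R = 16%:R ^+ 2); last by rewrite -natrX.
  by rewrite sqrtr_sqr ger0_norm ?ler0n // mulrA -natrM.
case: (posnP m) => [m0|m0]; last first.
  have [X [TX XT]] := good_points d0 m0 sm tau0 stau.
  by apply: (gn_le (X := X)) => //; rewrite mul2n -addnn; exact: XT.
(* Without samples, the tail is the whole sum and Cauchy-Schwarz bounds every function of the unit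
   ball. *)
have s0 : s = [::] by apply: size0nil; rewrite sm.
rewrite m0 muln0; apply: (gn_le (X := fun _ _ => 0)) => //.
  by move=> i j; rewrite lexx ler01.
move=> c x Tx c1 _.
have wc : Hw w c by apply/HwP; exists 1.
have := fval_sub_le x (s := [::]) isT wc c1; rewrite big_nil subr0 => H.
apply: le_trans (H tau _) _; last by rewrite ler_peMl ?ltW // ltr1n.
by rewrite -s0.
Qed.

End Sampling.

Theorem theorem2p2 :
  exists c1 c2 : nat,
  forall (R : realType) (d : nat) (w : freq d -> R) (m : nat),
    (0 < d)%N ->
    (forall k, 0 < w k) ->
    (\esum_(k in [set: freq d]) ((w k) ^-2)%:E < +oo)%E ->
    (gn w (c1 * m) <= (c2%:R)%:E * an1 w m)%E /\
    (forall sigma : nat -> freq d, bijective sigma ->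
       (forall i j : nat, (i <= j)%N -> w (sigma j) ^-2 <= w (sigma i) ^-2) ->
       an1 w m =
         (Num.sqrt (fine (\esum_(j in [set j : nat | (m <= j)%N]) ((w (sigma j)) ^-2)%:E)))%:E).
Proof.
(* The [2 * m] points are [m] starting points and [m] added ones; 32 is twice the square root of
   256. *)
exists 2%N, 32%N => R d w m d0 w0 wsum.
have lam0 k : 0 <= (w k) ^- 2 by rewrite invr_ge0 exprn_ge0 ?ltW.
have esum_fine (b : freq d -> R) : (forall k, 0 <= b k) -> (forall k, b k <= (w k) ^- 2) ->
    (\esum_(k in [set: freq d]) (b k)%:E = (fine (\esum_(k in [set: freq d]) (b k)%:E))%:E)%E.
  move=> b0 bw; rewrite fineK // ge0_fin_numE; last by apply: esum_ge0 => k _; rewrite lee_fin.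
  by apply: le_lt_trans wsum; apply: le_esum => k _; rewrite lee_fin.
have LamP : forall N, csum N (lam w) <= fine (\esum_(k in [set: freq d]) ((w k) ^- 2)%:E)%E.
  by apply/(esum_leP _ lam0); rewrite -esum_fine.
have offw s k : off s (lam w) k <= (w k) ^- 2 by rewrite /off; case: ifP.
have offE s := esum_fine _ (off_ge0 w0 s) (offw s).
split=> [|sigma bij sdec].
  have [s [us sm stop]] := exists_top_freqs w0 LamP m d0.
  rewrite (an1E w0 LamP d0 us sm stop (offE s)) -EFinM.
  exact: (gn_an1_le w0 LamP d0 us sm (offE s)).
pose s := [seq sigma i | i <- iota 0 m].
have sinj : injective sigma by exact: bij_inj.
have us : uniq s by rewrite map_inj_uniq ?iota_uniq.
have sm : size s = m by rewrite size_map size_iota.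
have sE j : (sigma j \in s) = (j < m)%N by rewrite mem_map // mem_iota.
have ssurj k : exists j, sigma j = k by have [g _ gK] := bij; exists (g k).
rewrite (an1E w0 LamP d0 us sm _ (offE s)).
  congr (Num.sqrt (fine _))%:E.
  (* Indices start at 0, so [s] takes the indices below [m], and the tail from index [m] begins with
     the value of rank [m + 1]. *)
  rewrite (@reindex_esum _ _ _ setT setT sigma); last first.
    split => //; first by move=> ? ? _ _ /sinj.
    by move=> k _; have [j <-] := ssurj k; exists j.
  rewrite [RHS]esum_mkcond; apply: eq_esum => j _.
  rewrite /off sE; case: ltnP => jm; last by rewrite mem_set.
  by rewrite memNset //= leqNgt jm.
move=> k l ks ls; have [[i ik] [j jl]] := (ssurj k, ssurj l).
move: ks ls; rewrite -ik -jl !sE -leqNgt => im mj.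
by apply: sdec; rewrite ltnW // (leq_trans im).
Qed.
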